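(* Let $R$ be an associative ring with unit. For any class $\mathcal{B}\subseteq\mathrm{Mod}(R^{op})$ of right $R$-modules, the class $\mathcal{GF}_{\mathcal{B}}(R)$ of Gorenstein $\mathcal{B}$-flat left $R$-modules is a precovering Kaplansky class in $\mathrm{Mod}(R)$.
   Context: A complex $X$ of left $R$-modules is $(\mathcal{B}\otimes_R-)$-acyclic if $B\otimes_RX$ is an exact complex for every $B\in\mathcal{B}$. A left $R$-module $M$ is Gorenstein $\mathcal{B}$-flat if $M=Z_0(F)=\mathrm{Ker}(F_0\to F_{-1})$ for some exact and $(\mathcal{B}\otimes_R-)$-acyclic complex $F$ of flat left $R$-modules. A class $\mathcal{A}$ of objects of a Grothendieck category $\mathcal{G}$ is a Kaplansky class if there is a regular cardinal $\kappa$ such that for any subobject $M\subseteq A$ with $0\neq A\in\mathcal{A}$ and $M$ $\kappa$-generated, there exists a $\kappa$-presentable object $S\neq0$ with $M\subseteq S\subseteq A$ and $S,A/S\in\mathcal{A}$. $\mathcal{A}$ is precovering if every object $M$ has an $\mathcal{A}$-precover, i.e. a morphism $\varphi\colon A\to M$ with $A\in\mathcal{A}$ such that every morphism $A'\to M$ with $A'\in\mathcal{A}$ factors through $\varphi$. *)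

(* Defs.v *)
From HB Require Import structures.
From mathcomp Require Import all_boot all_algebra.
From mathcomp Require Import generic_quotient ring_quotient.
From mathcomp Require Import boolp classical_sets cardinality.
From mathcomp.multinomials Require Import freeg.

Set Implicit Arguments.
Unset Strict Implicit.
Unset Printing Implicit Defensive.

Import GRing.Theory.
Local Open Scope ring_scope.

(* Left R-modules are [lmodType R]; right R-modules are left modules over the
   converse ring, [lmodType R^c], so that [b r] is [(r : R^c) *: b]. *)

(* The tensor product over a possibly noncommutative ring is the quotient of
   the free abelian group on B * M by the subgroup generated by the usual
   relations. It is only an abelian group. *)
Section Tensor.
Variables (R : pzRingType) (B : lmodType R^c) (M : lmodType R).

Local Notation Z := {freeg (B * M)%type / int}.

Definition freeg_pair (b : B) (m : M) : Z := << (b, m) >>.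

Inductive tensor_relator : Z -> Prop :=
| relator_addl b b' m :
    tensor_relator (freeg_pair (b + b') m - freeg_pair b m - freeg_pair b' m)
| relator_addr b m m' :
    tensor_relator (freeg_pair b (m + m') - freeg_pair b m - freeg_pair b m')
| relator_bal b (r : R) m :
    tensor_relator (freeg_pair ((r : R^c) *: b) m - freeg_pair b (r *: m)).

Definition tensor_rel : {pred Z} := fun z =>
  `[< forall S : zmodClosed Z, (forall u, tensor_relator u -> u \in S) ->
      z \in S >].

Lemma tensor_rel_closed : zmod_closed tensor_rel.
Proof.
split; first by apply/asboolP => S _; exact: rpred0.
move=> x y /asboolP hx /asboolP hy; apply/asboolP => S hS.
by rewrite rpredB ?hx ?hy.
Qed.

HB.instance Definition _ := GRing.isZmodClosed.Build Z tensor_rel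
  tensor_rel_closed.

Definition tensor : zmodType := Quotient.quot tensor_rel.

Definition tensor_proj (z : Z) : tensor := (\pi_(Quotient.quot tensor_rel) z)%qT.

Definition tens (b : B) (m : M) : tensor := tensor_proj (freeg_pair b m).

Lemma tensor_projP x y :
  tensor_proj x = tensor_proj y <-> x - y \in tensor_rel.
Proof. by rewrite Quotient.idealrBE; split=> [/eqP|/eqP]. Qed.

End Tensor.

Section TensorMap.
Variables (R : pzRingType) (B B' : lmodType R^c) (M M' : lmodType R).
Variables (f : {linear B -> B'}) (g : {linear M -> M'}).

Definition freeg_map : {freeg (B * M)%type / int} -> {freeg (B' * M')%type / int}
  := fglift (fun p => freeg_pair (f p.1) (g p.2)).

Lemma freeg_map_additive : zmod_morphism freeg_map.
Proof. exact: lift_is_additive. Qed.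

HB.instance Definition _ :=
  GRing.isZmodMorphism.Build _ _ freeg_map freeg_map_additive.

(* The map induced by [f] and [g]; [repr] picks a representative of the class,
   and [tensor_map_tens] shows that the choice is immaterial. *)
Definition tensor_map (x : tensor B M) : tensor B' M' :=
  tensor_proj (freeg_map (repr x)).

Lemma freeg_map_pair b m :
  freeg_map (freeg_pair b m) = freeg_pair (f b) (g m).
Proof. by rewrite /freeg_map /freeg_pair liftU scale1r. Qed.

Let preim_rel : {pred {freeg (B * M)%type / int}} :=
  fun z => freeg_map z \in @tensor_rel R B' M'.

Let preim_rel_closed : zmod_closed preim_rel.
Proof.
split; first by rewrite -topredE /= /preim_rel raddf0 rpred0.
by move=> x y hx hy; rewrite -topredE /= /preim_rel raddfB; apply: rpredB.
Qed.

HB.instance Definition _ := GRing.isZmodClosed.Build _ preim_rel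
  preim_rel_closed.

Lemma freeg_map_rel z :
  z \in @tensor_rel R B M -> freeg_map z \in @tensor_rel R B' M'.
Proof.
move=> /asboolP/(_ preim_rel); apply => u hu.
rewrite -topredE /= /preim_rel; apply/asboolP => S; apply.
case: hu => [b b' m|b m m'|b r m]; rewrite !raddfB /= !freeg_map_pair ?linearD
  ?linearZ.
- exact: relator_addl.
- exact: relator_addr.
- exact: relator_bal.
Qed.

Lemma tensor_map_proj z : tensor_map (tensor_proj z) = tensor_proj (freeg_map z).
Proof.
apply/tensor_projP; rewrite -raddfB; apply/freeg_map_rel/tensor_projP.
exact: reprK.
Qed.

Lemma tensor_map_tens b m : tensor_map (tens b m) = tens (f b) (g m).
Proof. by rewrite tensor_map_proj freeg_map_pair. Qed.

End TensorMap.

Definition exact_at (A B C : zmodType) (f : A -> B) (g : B -> C) : Prop :=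
  forall y, g y = 0 <-> exists x, f x = y.

Section Modules.
Variable R : pzRingType.

Definition flat (M : lmodType R) : Prop :=
  forall (A B C : lmodType R^c) (f : {linear A -> B}) (g : {linear B -> C}),
    exact_at f g ->
    exact_at (tensor_map f (idfun : {linear M -> M}))
             (tensor_map g (idfun : {linear M -> M})).

(* The differential leaving degree [n + 1] is [diff n]. *)
Record complex := Complex {
  obj :> int -> lmodType R;
  diff : forall n : int, {linear obj (n + 1) -> obj n};
  diffK : forall n x, diff n (diff (n + 1) x) = 0 }.

Definition exact_complex (X : complex) : Prop :=
  forall n, exact_at (diff X (n + 1)) (diff X n).

Definition acyclic (Bc : lmodType R^c -> Prop) (X : complex) : Prop :=
  forall B, Bc B -> forall n,
    exact_at (tensor_map (idfun : {linear B -> B}) (diff X (n + 1)))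
             (tensor_map (idfun : {linear B -> B}) (diff X n)).

(* [M] is identified with Ker(F_0 -> F_{-1}) through a kernel morphism [i]. *)
Definition gorenstein_flat (Bc : lmodType R^c -> Prop) (M : lmodType R) : Prop :=
  exists F : complex,
    [/\ forall n, flat (F n), exact_complex F, acyclic Bc F &
        exists i : {linear M -> F 0},
          injective i /\ exact_at i (diff F (- 1))].

Definition precovering (A : lmodType R -> Prop) : Prop :=
  forall M : lmodType R, exists (X : lmodType R) (phi : {linear X -> M}),
    A X /\ forall (X' : lmodType R) (f : {linear X' -> M}), A X' ->
      exists g : {linear X' -> X}, forall x, phi (g x) = f x.

End Modules.

(* Sets are small when they live in the universe of the carriers of modules.
   Cardinals and index posets must be small: a cardinal [K] from a larger
   universe could exceed every module and void the Kaplansky condition. *)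
Notation smallType := Type@{GRing.Lmodule.axioms_.u0}.

Section Cardinals.
Local Open Scope classical_set_scope.
Local Open Scope card_scope.

Definition card_lt (T U : Type) (A : set T) (B : set U) : Prop :=
  ~ (B #<= A).

(* The cardinal is that of the type [K]. *)
Definition regular_cardinal (K : smallType) : Prop :=
  infinite_set [set: K] /\
  forall (I : set K) (F : K -> set K), card_lt I [set: K] ->
    (forall i, I i -> card_lt (F i) [set: K]) ->
    card_lt (\bigcup_(i in I) F i) [set: K].

Record directed_poset (K : smallType) := DirectedPoset {
  idx :> smallType;
  le : idx -> idx -> Prop;
  le_refl : forall i, le i i;
  le_trans : forall i j k, le i j -> le j k -> le i k;
  le_anti : forall i j, le i j -> le j i -> i = j;
  le_directed : forall J : set idx, card_lt J [set: K] ->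
    exists u, forall j, J j -> le j u }.

End Cardinals.

Section Presentable.
Variables (R : pzRingType) (K : smallType).

Record diagram (I : directed_poset K) := Diagram {
  dobj :> I -> lmodType R;
  tr : forall i j, le i j -> {linear dobj i -> dobj j};
  tr_id : forall i (h : le i i) x, tr h x = x;
  tr_comp : forall i j k (h : le i j) (h' : le j k) (h'' : le i k) x,
    tr h' (tr h x) = tr h'' x }.

Variables (I : directed_poset K).

Definition cocone (D : diagram I) (C : lmodType R)
    (c : forall i, {linear D i -> C}) : Prop :=
  forall i j (h : le i j) x, c j (tr D h x) = c i x.

Definition is_colimit (D : diagram I) (C : lmodType R)
    (c : forall i, {linear D i -> C}) : Prop :=
  cocone c /\
  forall (E : lmodType R) (e : forall i, {linear D i -> E}), cocone e ->
    exists g : {linear C -> E}, (forall i x, g (c i x) = e i x) /\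
      forall g' : {linear C -> E}, (forall i x, g' (c i x) = e i x) -> g' =1 g.

(* Surjectivity and injectivity of the canonical map from the directed colimit
   of the sets Hom(M, D_i) to Hom(M, C). *)
Definition hom_preserves (M : lmodType R) (D : diagram I) (C : lmodType R)
    (c : forall i, {linear D i -> C}) : Prop :=
  (forall f : {linear M -> C},
     exists i (h : {linear M -> D i}), forall x, f x = c i (h x)) /\
  (forall i j (h : {linear M -> D i}) (h' : {linear M -> D j}),
     (forall x, c i (h x) = c j (h' x)) ->
     exists k (ik : le i k) (jk : le j k),
       forall x, tr D ik (h x) = tr D jk (h' x)).

End Presentable.

Section Kaplansky.
Variable R : pzRingType.

Definition presentable (K : smallType) (M : lmodType R) : Prop :=
  forall (I : directed_poset K) (D : diagram R I) (C : lmodType R)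
    (c : forall i, {linear D i -> C}), is_colimit c -> hom_preserves M c.

Definition generated (K : smallType) (M : lmodType R) : Prop :=
  forall (I : directed_poset K) (D : diagram R I) (C : lmodType R)
    (c : forall i, {linear D i -> C}),
    (forall i j (h : le i j), injective (tr D h)) ->
    is_colimit c -> hom_preserves M c.

Definition nonzero (M : lmodType R) : Prop := exists x : M, x <> 0.

Definition short_exact (S X Q : lmodType R) (s : {linear S -> X})
    (q : {linear X -> Q}) : Prop :=
  [/\ injective s, exact_at s q & forall y, exists x, q x = y].

(* Subobjects are given by injections: [m] is M in X, [s] is S in X, [t] is the
   inclusion of M in S, and [Q] is the quotient X/S. *)
Definition kaplansky (A : lmodType R -> Prop) : Prop :=
  exists K : smallType, regular_cardinal K /\
    forall (X M : lmodType R) (m : {linear M -> X}),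
      A X -> nonzero X -> injective m -> generated K M ->
      exists (S Q : lmodType R) (t : {linear M -> S}) (s : {linear S -> X})
        (q : {linear X -> Q}),
        [/\ nonzero S, presentable K S, forall x, s (t x) = m x,
            short_exact s q & A S /\ A Q].

End Kaplansky.

(* Main.v *)
Require Import Defs.
From HB Require Import structures.
From Stdlib Require List.
From mathcomp Require Import all_boot all_algebra.
From mathcomp Require Import generic_quotient ring_quotient.
From mathcomp Require Import boolp classical_sets functions cardinality wochoice.
From mathcomp.multinomials Require Import freeg.

(* Call a complex good if it is exact, (B (x) -)-acyclic and has flat terms, and a
   subcomplex U of X pure if every tensor relation and every boundary relation
   with right-hand side in U that is solvable in X is solvable in U. If X is good
   and U is pure, then U and X/U are good.

   A tensor relation involves finitely many elements, so a Loewenheim-Skolem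
   argument puts every small subset of X into a small pure subcomplex. Intersecting
   such a subcomplex with Z_0(X) gives the Kaplansky property.

   For precovers, a map Z_0(X) -> M is a map phi : X_1 -> M killing boundaries. Let P
   be a maximal pure subcomplex of ker phi. Then X/P has bounded size (the theorem of
   Bican, El Bashir and Enochs): otherwise, take a bounded subcomplex Y of X/P that
   reflects the systems of at most lambda relations (including values of phi), and a pure
   Y' strictly above Y with Y'/Y small. There is a small S with Y + S = Y', and S maps
   to Y by some theta that preserves phi and fixes S \cap Y. The s - theta(s) form a
   complement of Y in Y', which is a nonzero pure subcomplex of ker phi. The direct sum
   of representatives of all the good complexes of bounded size over M is therefore
   weakly terminal, and its Z_0 is a precover of M. *)

Set Implicit Arguments.
Unset Strict Implicit.
Unset Printing Implicit Defensive.

(** * Cardinals *)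

(** Purity reflects only finite systems, which is too weak to send all of S into Y at once. Hence
    there are two scales: the index type [L] of the systems that Y reflects contains [kappa0], the
    size of a small pure hull, so that an enumeration of S is a single [L]-indexed family and one
    solution in Y defines theta on all of S. The size bounds are types [L -> Prop] with [L] a type
    of binary trees. Pairs and sequences over [L] embed in [L], which gives kappa^L <= kappa, as a
    closure under Skolem functions of arity [L] requires. In purity, the tensor relations allow any
    h : B' -> B. Taking the differential or h to be an identity then treats flatness and acyclicity
    by the same diagram chases. Maps to M are placed in degree 1 because a map Z_0(X) -> M need not
    extend to X_0, whereas by exactness it can always be composed with the surjection X_1 ->
    Z_0(X). *)

Definition injects (A B : Type) : Prop := exists f : A -> B, injective f.

Definition covered (A X : Type) (S : X -> Prop) : Prop :=
  exists e : A -> X, forall x, S x -> exists a, e a = x.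

Lemma injects_refl A : injects A A.
Proof. by exists id. Qed.

Lemma injects_trans A B C : injects A B -> injects B C -> injects A C.
Proof. by move=> [f f_inj] [g g_inj]; exists (g \o f); apply: inj_comp. Qed.

Lemma injects_prod A B A' B' :
  injects A A' -> injects B B' -> injects (A * B) (A' * B').
Proof.
move=> [f f_inj] [g g_inj]; exists (fun p => (f p.1, g p.2)).
by move=> [a b] [a' b'] [/= /f_inj-> /g_inj->].
Qed.

Lemma injects_fun A B B' : injects B B' -> injects (A -> B) (A -> B').
Proof.
move=> [f f_inj]; exists (fun g a => f (g a)) => g h gh.
by apply/funext => a; apply: f_inj; apply: (congr1 (@^~ a) gh).
Qed.

Lemma injects_set A A' : injects A A' -> injects (A -> Prop) (A' -> Prop).
Proof.
move=> [f f_inj]; pose image S a' := exists2 a, S a & f a = a'.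
have image_f S a : image S (f a) = S a.
  apply/propext; split=> [[b Sb /f_inj <-] //|Sa]; by exists a.
exists image => S S' SS'; apply/funext => a.
by rewrite -image_f SS' image_f.
Qed.

Lemma injects_curry A B C : injects (A -> B -> C) (A * B -> C).
Proof.
exists (fun f p => f p.1 p.2) => f g fg; apply/funext => a; apply/funext => b.
exact: (congr1 (@^~ (a, b)) fg).
Qed.

Lemma covered_injects A B X (S : X -> Prop) (x0 : X) (f : A -> X) :
  injects A B -> (forall x, S x -> exists a, f a = x) -> covered B S.
Proof.
move=> [g g_inj] fS.
have /choice[h hg] (b : B) : exists x, forall a, g a = b -> f a = x.
  have [[a ab]|nb] := pselect (exists a, g a = b).
    by exists (f a) => a' a'b; congr f; apply: g_inj; rewrite ab.
  by exists x0 => a ab; case: nb; exists a.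
exists h => x /fS[a <-]; exists (g a); apply/esym/hg.
by [].
Qed.

Lemma covered_inverse A X : covered A (fun _ : X => True) -> injects X A.
Proof.
move=> [e eT]; have /choice[s se] x : exists a, e a = x by apply: eT.
exists s; exact: can_inj se.
Qed.

(** For inhabited [A], trees absorb pairs, sequences and countable types through their constructors,
    which replaces cardinal arithmetic. *)
Inductive bintree (A : Type) : Type :=
| bin_leaf of A
| bin_node of bintree A & bintree A.

Section Absorption.
Variables (A : Type) (a0 : A).
Local Notation L := (bintree A).

Lemma leaf_injects : injects A L.
Proof. by exists (@bin_leaf A) => x y []. Qed.

Lemma pair_injects : injects (L * L) L.
Proof. by exists (fun p => bin_node p.1 p.2) => -[x y] [x' y'] [/= -> ->]. Qed.

Lemma nat_injects : injects nat L.
Proof.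
exists (fix f n := if n is n'.+1 then bin_node (bin_leaf a0) (f n') else bin_leaf a0).
by elim=> [|n IHn] [|m] //= [/IHn->].
Qed.

Lemma seq_injects : injects (seq L) L.
Proof.
exists (fix f s := if s is x :: s' then bin_node x (f s') else bin_leaf a0).
by elim=> [|x s IHs] [|y r] //= [-> /IHs->].
Qed.

Lemma countable_injects (C : countType) : injects C L.
Proof. by apply: injects_trans nat_injects; exists pickle; apply: pcan_inj pickleK. Qed.

Local Notation kappa := (L -> Prop).

(** Currying turns (2^L)^X into 2^(X * L), and X * L embeds in L * L, hence in L. *)
Lemma power_injects X : injects X L -> injects (X -> kappa) kappa.
Proof.
move=> XL; apply: injects_trans (injects_curry _ _ _) _; apply: injects_set.
exact: injects_trans (injects_prod XL (injects_refl _)) pair_injects.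
Qed.

Lemma singleton_injects X : injects X L -> injects X kappa.
Proof.
move=> XL; apply: injects_trans XL _; exists (fun x y => x = y) => x y.
by move=> /(congr1 (@^~ y)) /= ->.
Qed.

Lemma kappa_prod X Y : injects X kappa -> injects Y kappa -> injects (X * Y) kappa.
Proof.
move=> Xk Yk; apply: injects_trans (injects_prod Xk Yk) _.
apply: injects_trans (power_injects (countable_injects bool)).
exists (fun p (b : bool) => if b then p.1 else p.2) => -[x y] [x' y'] /= xy.
by congr pair; [apply: (congr1 (@^~ true) xy)|apply: (congr1 (@^~ false) xy)].
Qed.

Lemma kappa_sum X Y : injects X kappa -> injects Y kappa -> injects (X + Y) kappa.
Proof.
move=> [f f_inj] [g g_inj].
apply: injects_trans (kappa_prod (injects_refl _) (injects_refl _)).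
exists (fun z => match z with inl x => ((fun _ => True), f x)
                            | inr y => ((fun _ => False), g y) end).
move=> [x|y] [x'|y'] [] //=.
- by move=> /f_inj->.
- by move=> /(congr1 (@^~ (bin_leaf a0))) /= TF; have : False by rewrite -TF.
- by move=> /(congr1 (@^~ (bin_leaf a0))) /= TF; have : False by rewrite TF.
- by move=> /g_inj->.
Qed.

Lemma kappa_option X : injects X kappa -> injects (option X) kappa.
Proof.
move=> Xk; apply: injects_trans (kappa_sum Xk (singleton_injects (countable_injects unit))).
by exists (fun o => if o is Some x then inl x else inr tt) => -[x|] [y|] //= [->].
Qed.

(** * Loewenheim-Skolem hulls for infinitary systems *)

Section Hull.
Variables (X V I G : Type) (y0 : G).
Variables (Rel : I -> X -> X -> X -> Prop) (f : X -> V) (g : G -> X).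
Hypotheses (VK : injects V kappa) (IL : injects I L) (GK : injects G kappa).

(* The positive atomic diagram of an [L]-indexed family, together with the set of
   its members that are parameters. *)
Record pattern := Pattern {
  param : L -> Prop;
  atoms : I -> L -> L -> L -> Prop;
  value : L -> V }.

Lemma pattern_injects : injects pattern kappa.
Proof.
apply: (@injects_trans _ ((L -> Prop) * (I * L * L * L -> Prop) * (L -> V))).
  exists (fun c => (param c, (fun p => atoms c p.1.1.1 p.1.1.2 p.1.2 p.2), value c)).
  move=> [p a v] [p' a' v'] /= [-> aa ->]; congr Pattern.
  apply/funext => i; apply/funext => x; apply/funext => y; apply/funext => z.
  exact: (congr1 (@^~ (i, x, y, z)) aa).
apply: kappa_prod; last first.
  exact: injects_trans (injects_fun _ VK) (power_injects (injects_refl _)).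
apply: kappa_prod; first exact: injects_refl.
apply: injects_set; do 3!apply: injects_trans (injects_prod _ (injects_refl _)) pair_injects.
exact: IL.
Qed.

Definition solves (c : pattern) (p b : L -> X) : Prop :=
  [/\ forall l, param c l -> b l = p l,
      forall i l1 l2 l3, atoms c i l1 l2 l3 -> Rel i (b l1) (b l2) (b l3) &
      forall l, f (b l) = value c l].

(** Terms for Skolem functions of arity [L]: a node stands for one entry of a chosen solution of its
    pattern, with the values of the subterms as parameters. *)
Inductive skolem : Type :=
| skolem_base of G
| skolem_node of pattern & (L -> skolem) & L.

(** A term branches over [L], but its paths are finite, so the labels along finite paths determine
    it. Terms thereby become functions on [seq L], of which there are at most [kappa]. *)
Fixpoint labels (w : skolem) (s : seq L) : option (G + pattern * L) :=
  match w, s with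
  | skolem_base x, [::] => Some (inl x)
  | skolem_base _, _ => None
  | skolem_node c _ l, [::] => Some (inr (c, l))
  | skolem_node _ k _, l :: s' => labels (k l) s'
  end.

Lemma labels_inj : injective labels.
Proof.
elim=> [x|c k IHk l] [y|c' k' l'] ww'; have := congr1 (@^~ [::]) ww' => //= -[].
  by move=> ->.
move=> -> ->; congr skolem_node; apply/funext => m; apply: IHk.
by apply/funext => s; apply: (congr1 (@^~ (m :: s)) ww').
Qed.

Lemma skolem_injects : injects skolem kappa.
Proof.
apply: injects_trans (ex_intro _ labels labels_inj) _.
apply: injects_trans (power_injects seq_injects); apply: injects_fun.
apply/kappa_option/kappa_sum/kappa_prod => //; first exact: pattern_injects.
exact/singleton_injects/injects_refl.
Qed.

(** S consists of the values of the Skolem terms. The atomic diagram of [a], with the entries in S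
    as parameters, is solved by [a] itself. So the chosen solution is a genuine one, and its entries
    are again values of terms. *)
Lemma reflective_hull : exists S : X -> Prop,
  [/\ covered kappa S, forall x, S (g x) &
    forall a : L -> X, exists b : L -> X,
      [/\ forall l, S (b l), forall l, S (a l) -> b l = a l,
        forall i l1 l2 l3, Rel i (a l1) (a l2) (a l3) -> Rel i (b l1) (b l2) (b l3) &
        forall l, f (b l) = f (a l)]].
Proof.
(* One solution is fixed for each solvable pattern with parameters; the constant family [g y0] is
   the default for the others. *)
have /choice[sol solP] (cp : pattern * (L -> X)) : exists b,
    (exists b', solves cp.1 cp.2 b') -> solves cp.1 cp.2 b.
  have [[b bP]|nb] := pselect (exists b', solves cp.1 cp.2 b'); first by exists b.
  by exists (fun=> g y0) => /nb.
pose ev := fix ev w := match w with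
  | skolem_base x => g x
  | skolem_node c k l => sol (c, fun m => ev (k m)) l end.
exists (fun x => exists w, ev w = x); split.
- exact: (covered_injects (f := ev) (g y0) skolem_injects).
- by move=> x; exists (skolem_base x).
move=> a; have /choice[k kP] l : exists w, (exists w', ev w' = a l) -> ev w = a l.
  have [[w wP]|nw] := pselect (exists w', ev w' = a l); first by exists w.
  by exists (skolem_base y0) => /nw.
pose c := Pattern (fun l => exists w, ev w = a l)
  (fun i l1 l2 l3 => Rel i (a l1) (a l2) (a l3)) (fun l => f (a l)).
have [|bpar brel bval] := solP (c, fun l => ev (k l)).
  by exists a; split=> //= l /kP.
exists (sol (c, fun l => ev (k l))); split=> // [l|l al].
- by exists (skolem_node c k l).
- by rewrite bpar //=; apply: kP.
Qed.

End Hull.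
End Absorption.

(** * Successor cardinals and their regularity *)

Section SuccessorCardinals.

Local Open Scope classical_set_scope.

Lemma card_le_injection (K U : Type) (A : set U) :
  card_le [set: K] A <-> exists2 f : K -> U, injective f & forall x, A (f x).
Proof.
split=> [/card_leP[f]|[f f_inj fA]].
  pose h x := f (exist _ x (mem_set (I : [set: K] x))).
  exists (fun x => val (h x)) => [x y /val_inj|x]; last exact: set_mem (valP (h x)).
  by move=> /(@inj _ _ _ f _ _ (mem_set I) (mem_set I)) [].
have /injfunPex[g] : exists2 f : K -> U, set_fun [set: K] A f & set_inj [set: K] f.
  by exists f => [x _|x y _ _ /f_inj //]; apply: fA.
exact: inj_card_le g.
Qed.

Lemma Cantor (k : Type) : ~ injects (k -> Prop) k.
Proof.
move=> [f f_inj]; pose D x := exists2 S, f S = x & ~ S x.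
have notD : ~ D (f D) by move=> /[dup] D1 [S /f_inj ->]; apply.
by apply: (notD); exists D.
Qed.

(* Minimal initial segment of a well-ordered power set that does not inject
   into [k]. *)
Lemma successor_order (k : Type) : exists (D : (k -> Prop) -> Prop)
    (lt : {S | D S} -> {S | D S} -> Prop),
  [/\ ~ injects {S | D S} k, well_founded lt,
    forall x y, x <> y -> lt x y \/ lt y x & forall x, injects {y | lt y x} k].
Proof.
pose W : eqType := HB.pack (k -> Prop) (gen_eqMixin (k -> Prop)).
have [R Rwo] := well_ordering_principle W.
pose lt (x y : W) := R x y /\ x <> y.
have Rmin (P : W -> Prop) x : P x -> exists z,
    [/\ P z, forall y, P y -> R z y &
      forall z', P z' -> (forall y, P y -> R z' y) -> z = z'].
  move=> Px; have [|z [[/asboolP Pz zmin] zuniq]] := Rwo (fun y => `[< P y >]).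
    by exists x; apply/asboolP.
  exists z; split=> // [y Py|z' Pz' z'min]; first by apply: zmin; apply/asboolP.
  by apply: zuniq; split=> [|y /asboolP]; [apply/asboolP|apply: z'min].
(* Reflexivity, antisymmetry and totality all come from the unique least elements of {x} and {x,
   y}. *)
have Rxx x : R x x by have [z [-> zmin _]] := Rmin (eq x) x erefl; apply: zmin.
have Ranti x y : R x y -> R y x -> x = y.
  move=> xy yx; have [z [_ _ zuniq]] := Rmin (fun u => u = x \/ u = y) x (or_introl erefl).
  have <- : z = x by apply: zuniq => [|u [->|->]]; [left|apply: Rxx|].
  by apply: zuniq => [|u [->|->]]; [right|  |apply: Rxx].
have Rtot x y : R x y \/ R y x.
  have [z [[->|->] zmin _]] := Rmin (fun u => u = x \/ u = y) x (or_introl erefl).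
    by left; apply: zmin; right.
  by right; apply: zmin; left.
have lt_wf : well_founded lt.
  move=> x; apply: contrapT => /(Rmin (fun x => ~ Acc lt x))[z [nz zmin _]].
  apply: nz; constructor=> y [yz ynz]; apply: contrapT => /zmin zy.
  by apply: ynz; apply: Ranti.
(* If some element has a segment too large for [k], the segment below the least such element works.
   Otherwise all of [W] does, being too large by Cantor's theorem. *)
have [D [nD Dk]] : exists D : W -> Prop, ~ injects {S | D S} k /\
    forall x, D x -> injects {y | lt y x} k.
  have [[p np]|all_small] := pselect (exists x, ~ injects {y | lt y x} k); last first.
    exists (fun=> True); split=> [kD|x _]; last first.
      by apply: contrapT => nx; apply: all_small; exists x.
    apply: (@Cantor k); apply: injects_trans kD; exists (fun S => exist _ S I).
    by move=> S T [].
  have [z [nz zmin _]] := Rmin (fun x => ~ injects {y | lt y x} k) p np.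
  exists (fun y => lt y z); split=> // x [xz nxz]; apply: contrapT => /zmin zx.
  by apply: nxz; apply: Ranti.
exists D, (fun x y => lt (sval x) (sval y)); split.
- exact: nD.
- suff acc w : Acc lt w -> forall x : {S | D S}, sval x = w ->
      Acc (fun x y : {S | D S} => lt (sval x) (sval y)) x by move=> x; apply: acc erefl.
  by elim=> {}w _ IHw x xw; constructor=> y; rewrite xw => yw; apply: IHw yw _ _.
- move=> [x Dx] [y Dy] xy; have nxy : x <> y.
    by move=> exy; apply: xy; subst y; rewrite (Prop_irrelevance Dx Dy).
  have [Rxy|Ryx] := Rtot x y; [left|right]; split; [exact: Rxy|exact: nxy|exact: Ryx|].
  by move=> /esym.
- move=> [x Dx]; apply: injects_trans (Dk x Dx).
  exists (fun y => exist (fun y => lt y x) (sval (sval y)) (svalP y)).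
  move=> [[y Dy] yx] [[y' Dy'] y'x] /= [yy']; subst y'.
  rewrite (Prop_irrelevance Dy' Dy) in y'x *.
  by rewrite (Prop_irrelevance yx y'x).
Qed.

Section Successor.
Variable k : smallType.
Hypotheses (nat_k : injects nat k) (k_square : injects (k * k) k).

(** [K] is the successor of [k]: smaller than [K] means covered by [k], so regularity reduces to
    [k * k] fitting into [k]. *)
Lemma successor_cardinal : exists K : smallType, [/\ regular_cardinal K,
  forall (U : Type) (u0 : U) (A : set U), card_lt A [set: K] -> covered k A &
  forall (U : Type) (A : set U), covered k A -> card_lt A [set: K]].
Proof.
have [D [lt [nD lt_wf lt_total lt_small]]] := successor_order k.
pose K : smallType := {S | D S}; exists K.
have small_lt (U : Type) (A : set U) : covered k A -> card_lt A [set: K].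
  move=> [e eA] /card_le_injection[f f_inj fA]; apply: nD.
  have /choice[g gP] x : exists a, e a = f x by apply: eA.
  by exists g => x y gxy; apply: f_inj; rewrite -!gP gxy.
have lt_covered (U : Type) (u0 : U) (A : set U) : card_lt A [set: K] -> covered k A.
  move=> nKA.
  pose fresh x (h : forall y, lt y x -> U) u := A u /\ forall y yx, h y yx <> u.
  pose F x (h : forall y, lt y x -> U) : U :=
    if pselect (exists u, fresh x h u) is left ex then projT1 (cid ex) else u0.
  pose g := Fix lt_wf (fun=> U) F.
  have gE x : g x = F x (fun y _ => g y).
    apply: Fix_eq => y h h' hh'; congr F.
    apply: functional_extensionality_dep => z.
    by apply: functional_extensionality_dep => zy.
  have [allfresh|] := pselect (forall x, exists u, fresh x (fun y _ => g y) u).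
    have gP x : fresh x (fun y _ => g y) (g x).
      by rewrite [in X in fresh _ _ X]gE /F; case: pselect => // ex; case: cid.
    case: nKA; apply/card_le_injection; exists g => [x y gxy|x]; last by have [] := gP x.
    apply: contrapT => /lt_total[] xy.
      by have [_ /(_ _ xy)] := gP y; apply.
    by have [_ /(_ _ xy)] := gP x; apply.
  move=> /existsNP[x nx].
  apply: (covered_injects (f := fun y : {y | lt y x} => g (sval y)) u0 (lt_small x)).
  move=> u Au; apply: contrapT => ngu; apply: nx; exists u; split=> // y yx gyu.
  by apply: ngu; exists (exist _ y yx).
split=> //; split.
  move=> /finite_set_countable/card_le_injection[f f_inj _].
  by apply: nD; apply: injects_trans nat_k; exists f.
have [x0|nK] := pselect (inhabited K); last first.
  by case: nD; exists (fun x => False_rect _ (nK (inhabits x))) => x; case: nK.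
case: x0 => x0 I F /(lt_covered _ x0)[e eI] Fsmall.
have /choice[h hP] i : exists h : k -> K, I i -> forall x, F i x -> exists a, h a = x.
  have [Ii|nIi] := pselect (I i); last by exists (fun=> x0).
  by have [h hP] := lt_covered _ x0 _ (Fsmall i Ii); exists h.
apply: small_lt.
apply: (covered_injects (f := fun p => h (e p.1) p.2) x0 k_square) => x [i Ii Fx].
have [a ai] := eI i Ii; have [b bx] := hP i Ii x Fx.
by exists (a, b); rewrite /= ai.
Qed.

End Successor.

End SuccessorCardinals.

(** * Modules *)

Import GRing.Theory.
Local Open Scope ring_scope.

Section LinearMaps.
Variable R : pzRingType.
Implicit Types U V W : lmodType R.

Definition mk_linear U V (f : U -> V) (f_linear : linear f) : {linear U -> V} :=
  HB.pack f (GRing.isLinear.Build R U V *:%R f f_linear).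

(** Closure under linear combinations reduces uniqueness of values to uniqueness at 0. Maps defined
    through a choice of preimages or representatives are built this way. *)
Lemma linear_of_relation U V (G : U -> V -> Prop) :
  (forall u, exists v, G u v) -> (forall v, G 0 v -> v = 0) ->
  (forall a u v u' v', G u v -> G u' v' -> G (a *: u + u') (a *: v + v')) ->
  exists g : {linear U -> V}, forall u v, G u v <-> g u = v.
Proof.
move=> /choice[g gP] G0 GD.
have g_unique u v : G u v -> g u = v.
  move=> uv; apply/eqP; rewrite -subr_eq0; apply/eqP/G0.
  rewrite -[in G 0](subrr u) [u - u]addrC [g u - v]addrC -!scaleN1r.
  exact: GD.
have g_linear : linear g by move=> a u u'; apply/g_unique/GD.
exists (mk_linear g_linear) => u v; split=> [/g_unique //|<-].
exact: gP.
Qed.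

Lemma factor_injective U V W (i : {linear V -> W}) (h : {linear U -> W}) :
  injective i -> (forall u, exists v, i v = h u) ->
  exists g : {linear U -> V}, forall u, i (g u) = h u.
Proof.
move=> i_inj hi.
have [v|a u v u' v' uv uv'|g gP] :=
    @linear_of_relation U V (fun u v => i v = h u) hi.
- by rewrite linear0 -[X in _ = X](linear0 i) => /i_inj.
- by rewrite !linearP uv uv'.
by exists g => u; apply/gP.
Qed.

Lemma factor_surjective U V W (q : {linear U -> V}) (h : {linear U -> W}) :
  (forall v, exists u, q u = v) -> (forall u, q u = 0 -> h u = 0) ->
  exists g : {linear V -> W}, forall u, g (q u) = h u.
Proof.
move=> q_surj qh.
have [|w [u [qu0 <-]]|a v w v' w' [u [<- <-]] [u' [<- <-]]|g gP] :=
    @linear_of_relation V W (fun v w => exists u, q u = v /\ h u = w).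
- by move=> v; have [u uv] := q_surj v; exists (h u), u.
- exact: qh.
- by exists (a *: u + u'); rewrite !linearP.
by exists g => u; apply/gP; exists u.
Qed.

End LinearMaps.

Section Submodules.
Variables (R : pzRingType) (X : lmodType R).

Record submod := Submod {
  submod_mem :> X -> Prop;
  submod0 : submod_mem 0;
  submodP : forall a x y, submod_mem x -> submod_mem y ->
    submod_mem (a *: x + y) }.

Implicit Types U V : submod.

Lemma submodZ U a x : U x -> U (a *: x).
Proof. by move=> Ux; rewrite -[_ *: _]addr0; apply/submodP/submod0. Qed.

Lemma submodD U x y : U x -> U y -> U (x + y).
Proof. by move=> Ux Uy; rewrite -[x]scale1r; apply: submodP. Qed.

Lemma submodN U x : U x -> U (- x).
Proof. by rewrite -scaleN1r; apply: submodZ. Qed.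

Lemma submodB U x y : U x -> U y -> U (x - y).
Proof. by move=> Ux /submodN; apply: submodD. Qed.

Lemma submod_eqP U V : (forall x, U x <-> V x) -> U = V.
Proof.
case: U V => [U U0 UP] [V V0 VP] /= UV.
have eUV : U = V by apply/funext => x; apply/propext.
by subst V; congr Submod; apply: Prop_irrelevance.
Qed.

Definition submod_pred U : {pred X} := fun x => `[< U x >].

Lemma submod_pred_closed U : submod_closed (submod_pred U).
Proof.
split; first exact/asboolP/submod0.
by move=> a x y /asboolP Ux /asboolP Uy; apply/asboolP/submodP.
Qed.

HB.instance Definition _ U :=
  GRing.isSubmodClosed.Build R X (submod_pred U) (submod_pred_closed U).

Record submod_type U := SubElement {
  sub_val : X; sub_valP : sub_val \in submod_pred U }.

HB.instance Definition _ U := [isSub for @sub_val U].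
HB.instance Definition _ U := [Choice of submod_type U by <:].
HB.instance Definition _ U := [SubChoice_isSubLmodule of submod_type U by <:].

Definition incl U : {linear submod_type U -> X} := val.

Lemma incl_inj U : injective (incl U).
Proof. exact: val_inj. Qed.

Lemma incl_mem U x : U (incl U x).
Proof. by have /asboolP := sub_valP x. Qed.

Lemma inclP U x : U x -> exists y, incl U y = x.
Proof. by move=> /asboolP Ux; exists (SubElement Ux). Qed.

HB.instance Definition _ U := GRing.isZmodClosed.Build X (submod_pred U)
  (GRing.submod_closedB (submod_pred_closed U)).

Definition quomod_type U : Type := Quotient.quot (submod_pred U).
HB.instance Definition _ U := GRing.Zmodule.on (quomod_type U).

Definition proj_fun U (x : X) : quomod_type U :=
  (\pi_(Quotient.quot (submod_pred U)) x)%qT.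

Lemma proj_funP U x y : proj_fun U x = proj_fun U y <-> U (x - y).
Proof.
split=> [/eqP|Uxy]; first by rewrite -Quotient.idealrBE => /asboolP.
by apply/eqP; rewrite -Quotient.idealrBE; apply/asboolP.
Qed.

Lemma proj_fun_repr U (y : quomod_type U) : proj_fun U (repr y) = y.
Proof. exact: reprK. Qed.

Lemma proj_funD U x y : proj_fun U (x + y) = proj_fun U x + proj_fun U y.
Proof. exact: raddfD. Qed.

Definition quo_scale U (a : R) (y : quomod_type U) := proj_fun U (a *: repr y).

Lemma quo_scaleE U a x : quo_scale a (proj_fun U x) = proj_fun U (a *: x).
Proof.
by apply/proj_funP; rewrite -scalerBr; apply/submodZ/proj_funP/proj_fun_repr.
Qed.

Lemma quo_scaleA U a b (y : quomod_type U) :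
  quo_scale a (quo_scale b y) = quo_scale (a * b) y.
Proof. by rewrite -[y]proj_fun_repr !quo_scaleE scalerA. Qed.

Lemma quo_scale1 U : left_id 1 (@quo_scale U).
Proof. by move=> y; rewrite -[y]proj_fun_repr quo_scaleE scale1r. Qed.

Lemma quo_scaleDr U : right_distributive (@quo_scale U) +%R.
Proof.
move=> a y z; rewrite -[y]proj_fun_repr -[z]proj_fun_repr -proj_funD.
by rewrite !quo_scaleE scalerDr proj_funD.
Qed.

Lemma quo_scaleDl U (y : quomod_type U) : {morph (@quo_scale U)^~ y : a b / a + b}.
Proof.
by move=> a b /=; rewrite -[y]proj_fun_repr !quo_scaleE scalerDl proj_funD.
Qed.

HB.instance Definition _ U := GRing.Zmodule_isLmodule.Build R (quomod_type U)
  (@quo_scaleA U) (@quo_scale1 U) (@quo_scaleDr U) (@quo_scaleDl U).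

Lemma proj_fun_linear U : linear (proj_fun U).
Proof. by move=> a x y; rewrite proj_funD -quo_scaleE. Qed.

Definition proj U : {linear X -> quomod_type U} := mk_linear (@proj_fun_linear U).

Lemma proj_surj U y : exists x, proj U x = y.
Proof. by exists (repr y); apply: proj_fun_repr. Qed.

Lemma proj_eq U x y : proj U x = proj U y <-> U (x - y).
Proof. exact: proj_funP. Qed.

Lemma proj_eq0 U x : proj U x = 0 <-> U x.
Proof. by rewrite -[0](linear0 (proj U)) proj_eq subr0. Qed.

Lemma proj_incl U x : proj U (incl U x) = 0.
Proof. exact/proj_eq0/incl_mem. Qed.

End Submodules.

Arguments incl {R X} U : simpl never.
Arguments proj {R X} U : simpl never.

Section LinearSubmodules.
Variable R : pzRingType.
Implicit Types X Y : lmodType R.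

Definition submod_preimage X Y (f : {linear X -> Y}) (U : submod Y) : submod X.
Proof.
exists (fun x => U (f x)) => [|a x y Ux Uy]; first by rewrite linear0; apply: submod0.
by rewrite linearP; apply: submodP.
Defined.

Lemma submod_preimageE X Y (f : {linear X -> Y}) (U : submod Y) x :
  submod_preimage f U x = U (f x).
Proof. by []. Qed.

Definition zero_submod X : submod X.
Proof. by exists (fun x => x = 0) => // a x y -> ->; rewrite scaler0 addr0. Defined.

Definition submod_kernel X Y (f : {linear X -> Y}) := submod_preimage f (zero_submod Y).

End LinearSubmodules.

Section Products.
Variables (R : pzRingType) (J : Type) (V : J -> lmodType R).

Definition product : Type := forall j, V j.

Implicit Types f g : product.

HB.instance Definition _ := gen_eqMixin product.
HB.instance Definition _ := gen_choiceMixin product.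

Definition product_add f g : product := fun j => f j + g j.
Definition product_opp f : product := fun j => - f j.
Definition product_zero : product := fun j => 0.
Definition product_scale (a : R) f : product := fun j => a *: f j.

Lemma product_addA : associative product_add.
Proof. by move=> f g h; apply: functional_extensionality_dep => j; apply: addrA. Qed.
Lemma product_addC : commutative product_add.
Proof. by move=> f g; apply: functional_extensionality_dep => j; apply: addrC. Qed.
Lemma product_add0 : left_id product_zero product_add.
Proof. by move=> f; apply: functional_extensionality_dep => j; apply: add0r. Qed.
Lemma product_addN : left_inverse product_zero product_opp product_add.
Proof. by move=> f; apply: functional_extensionality_dep => j; apply: addNr. Qed.

HB.instance Definition _ := GRing.isZmodule.Build product
  product_addA product_addC product_add0 product_addN.

Lemma product_scaleA a b f :
  product_scale a (product_scale b f) = product_scale (a * b) f.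
Proof. by apply: functional_extensionality_dep => j; apply: scalerA. Qed.
Lemma product_scale1 : left_id 1 product_scale.
Proof. by move=> f; apply: functional_extensionality_dep => j; apply: scale1r. Qed.
Lemma product_scaleDr : right_distributive product_scale +%R.
Proof. by move=> a f g; apply: functional_extensionality_dep => j; apply: scalerDr. Qed.
Lemma product_scaleDl f : {morph product_scale^~ f : a b / a + b}.
Proof. by move=> a b; apply: functional_extensionality_dep => j; apply: scalerDl. Qed.

HB.instance Definition _ := GRing.Zmodule_isLmodule.Build R product
  product_scaleA product_scale1 product_scaleDr product_scaleDl.

Lemma productDE f g j : (f + g) j = f j + g j. Proof. by []. Qed.
Lemma productZE a f j : (a *: f) j = a *: f j. Proof. by []. Qed.

End Products.

(** * Tensor products *)

Section SubgroupInduction.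
Variables (V : zmodType) (P : V -> Prop).
Hypotheses (P0 : P 0) (PB : forall x y, P x -> P y -> P (x - y)).

Definition subgroup_pred : {pred V} := fun x => `[< P x >].

Lemma subgroup_pred_closed : zmod_closed subgroup_pred.
Proof.
split; first exact/asboolP.
by move=> x y /asboolP Px /asboolP Py; apply/asboolP/PB.
Qed.

HB.instance Definition _ :=
  GRing.isZmodClosed.Build V subgroup_pred subgroup_pred_closed.

Definition subgroup : zmodClosed V := subgroup_pred.

Lemma subgroup_sum (I : Type) (r : seq I) (F : I -> V) :
  (forall i, P (F i)) -> P (\sum_(i <- r) F i).
Proof.
move=> PF; suff /asboolP : \sum_(i <- r) F i \in subgroup_pred by [].
by apply: rpred_sum => i _; apply/asboolP/PF.
Qed.

Lemma subgroupMz x (k : int) : P x -> P (x *~ k).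
Proof. by move=> /asboolP Px; apply/asboolP/(@rpredMz _ subgroup_pred). Qed.

End SubgroupInduction.

Lemma freeg_ind (K : choiceType) (P : {freeg K / int} -> Prop) :
  P 0 -> (forall x y, P x -> P y -> P (x - y)) -> (forall k, P << k >>) ->
  forall z, P z.
Proof.
move=> P0 PB Pk z; rewrite -[z]freeg_sumE; apply: subgroup_sum => // k.
by rewrite -[coeff k z]intz -freegU_mulz; apply: subgroupMz.
Qed.

Section Tensor.
Variables (R : pzRingType) (B : lmodType R^c) (M : lmodType R).
Implicit Types (x y : tensor B M) (z : {freeg (B * M)%type / int}).

(** The relations lie in every subgroup that contains the relators, in particular in the one defined
    by [P]. *)
Lemma tensor_rel_ind (P : {freeg (B * M)%type / int} -> Prop) :
  P 0 -> (forall z z', P z -> P z' -> P (z - z')) ->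
  (forall u, tensor_relator u -> P u) ->
  forall z, z \in @tensor_rel R B M -> P z.
Proof.
move=> P0 PB Prel z /asboolP zrel.
have /asboolP : z \in subgroup P0 PB by apply: zrel => u /Prel Pu; apply/asboolP.
by [].
Qed.

Lemma tensor_relator_rel z : tensor_relator z -> z \in @tensor_rel R B M.
Proof. by move=> zrel; apply/asboolP => S; apply. Qed.

Lemma tensor_projB z z' :
  tensor_proj (z - z') = tensor_proj z - tensor_proj z'.
Proof. exact: raddfB. Qed.

Lemma tensor_proj0 : tensor_proj (0 : {freeg (B * M)%type / int}) = 0.
Proof. exact: raddf0. Qed.

Lemma tensor_reprK x : tensor_proj (repr x) = x.
Proof. exact: reprK. Qed.

Lemma tensor_proj_eq0 z : tensor_proj z = 0 <-> z \in @tensor_rel R B M.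
Proof. by rewrite -tensor_proj0 tensor_projP subr0. Qed.

Lemma tensor_ind (P : tensor B M -> Prop) :
  P 0 -> (forall x y, P x -> P y -> P (x - y)) -> (forall b m, P (tens b m)) ->
  forall x, P x.
Proof.
move=> P0 PB Pt x; rewrite -[x]tensor_reprK.
elim/freeg_ind: (repr x) => [|z z' Pz Pz'|[b m]]; last exact: Pt.
  by rewrite tensor_proj0.
by rewrite tensor_projB; apply: PB.
Qed.

Lemma tensDr b (m m' : M) : tens b (m + m') = tens b m + tens b m' :> tensor B M.
Proof.
apply/eqP; rewrite addrC -subr_eq -subr_eq0 -!tensor_projB addrAC.
apply/eqP/tensor_proj_eq0/tensor_relator_rel; rewrite -addrA [- _ - _]addrC addrA.
exact: relator_addr.
Qed.

Lemma tensDl (b b' : B) (m : M) : tens (b + b') m = tens b m + tens b' m :> tensor B M.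
Proof.
apply/eqP; rewrite addrC -subr_eq -subr_eq0 -!tensor_projB addrAC.
apply/eqP/tensor_proj_eq0/tensor_relator_rel; rewrite -addrA [- _ - _]addrC addrA.
exact: relator_addl.
Qed.

Lemma tens_balanced (b : B) (r : R) (m : M) :
  tens ((r : R^c) *: b) m = tens b (r *: m) :> tensor B M.
Proof. by apply/tensor_projP/tensor_relator_rel/relator_bal. Qed.

Lemma tens0r (b : B) : tens b 0 = 0 :> tensor B M.
Proof. by apply: (addrI (tens b 0)); rewrite -tensDr !addr0. Qed.

Lemma tensNr (b : B) (m : M) : tens b (- m) = - tens b m :> tensor B M.
Proof. by apply/eqP; rewrite -addr_eq0 -tensDr addNr tens0r. Qed.

Lemma tensBr b (m m' : M) : tens b (m - m') = tens b m - tens b m' :> tensor B M.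
Proof. by rewrite tensDr tensNr. Qed.

End Tensor.

Section TensorMap.
Variables (R : pzRingType).
Implicit Types (B : lmodType R^c) (M : lmodType R).

Lemma tensor_map_is_additive B B' M M' (f : {linear B -> B'}) (g : {linear M -> M'}) :
  zmod_morphism (tensor_map f g).
Proof.
move=> x y; rewrite -[x]tensor_reprK -[y]tensor_reprK -tensor_projB.
by rewrite !tensor_map_proj raddfB tensor_projB.
Qed.

HB.instance Definition _ B B' M M' (f : {linear B -> B'}) (g : {linear M -> M'}) :=
  GRing.isZmodMorphism.Build _ _ (tensor_map f g) (tensor_map_is_additive f g).

Lemma tensor_hom_ext B M (V : zmodType) (f g : {additive tensor B M -> V}) :
  (forall b m, f (tens b m) = g (tens b m)) -> f =1 g.
Proof.
move=> fg; elim/tensor_ind => [|x y fgx fgy|//]; first by rewrite !raddf0.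
by rewrite !raddfB fgx fgy.
Qed.

Lemma tensor_map_comp B B' B'' M M' M'' (f : {linear B -> B'})
    (f' : {linear B' -> B''}) (g : {linear M -> M'}) (g' : {linear M' -> M''})
    (f'' : {linear B -> B''}) (g'' : {linear M -> M''}) :
  (forall b, f' (f b) = f'' b) -> (forall m, g' (g m) = g'' m) ->
  forall x, tensor_map f' g' (tensor_map f g x) = tensor_map f'' g'' x.
Proof.
move=> ff gg; apply: (tensor_hom_ext (f := (tensor_map f' g' \o tensor_map f g))).
by move=> b m /=; rewrite !tensor_map_tens ff gg.
Qed.

Lemma tensor_map_square B0 B1 B2 B3 M0 M1 M2 M3
    (f : {linear B0 -> B1}) (f' : {linear B1 -> B3})
    (h : {linear B0 -> B2}) (h' : {linear B2 -> B3})
    (g : {linear M0 -> M1}) (g' : {linear M1 -> M3})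
    (k : {linear M0 -> M2}) (k' : {linear M2 -> M3}) :
  (forall b, f' (f b) = h' (h b)) -> (forall m, g' (g m) = k' (k m)) ->
  forall x, tensor_map f' g' (tensor_map f g x) = tensor_map h' k' (tensor_map h k x).
Proof.
move=> fh gk; apply: (tensor_hom_ext (f := (tensor_map f' g' \o tensor_map f g))
  (g := (tensor_map h' k' \o tensor_map h k))).
by move=> b m /=; rewrite !tensor_map_tens fh gk.
Qed.

Lemma tensor_map_id B M (f : {linear B -> B}) (g : {linear M -> M}) :
  f =1 id -> g =1 id -> tensor_map f g =1 id.
Proof.
move=> f1 g1; apply: (tensor_hom_ext (g := idfun)) => b m /=.
by rewrite tensor_map_tens f1 g1.
Qed.

Lemma tensor_map_eq B B' M M' (f f' : {linear B -> B'}) (g g' : {linear M -> M'}) :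
  f =1 f' -> g =1 g' -> tensor_map f g =1 tensor_map f' g'.
Proof.
move=> ff' gg'; apply: tensor_hom_ext => b m /=.
by rewrite !tensor_map_tens ff' gg'.
Qed.

Lemma tensor_map0 B B' M M' (f : {linear B -> B'}) (g : {linear M -> M'}) :
  (forall m, g m = 0) -> forall x, tensor_map f g x = 0.
Proof.
move=> g0; apply: (tensor_hom_ext (g := \0)) => b m /=.
by rewrite tensor_map_tens g0 tens0r.
Qed.

Lemma tensor_map0l B B' M M' (f : {linear B -> B'}) (g : {linear M -> M'}) :
  (forall b, f b = 0) -> forall x, tensor_map f g x = 0.
Proof.
move=> f0; apply: (tensor_hom_ext (g := \0)) => b m /=.
rewrite tensor_map_tens f0; apply: (addrI (tens 0 (g m))).
by rewrite -tensDl !addr0.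
Qed.

Lemma tensor_map_surj B M M' (g : {linear M -> M'}) :
  (forall m', exists m, g m = m') ->
  forall x, exists y, tensor_map (idfun : {linear B -> B}) g y = x.
Proof.
move=> g_surj; elim/tensor_ind => [|_ _ [y <-] [y' <-]|b m'].
- by exists 0; apply: raddf0.
- by exists (y - y'); rewrite raddfB.
- by have [m <-] := g_surj m'; exists (tens b m); rewrite tensor_map_tens.
Qed.

(* The set-theoretic section [repr] of [q] is linear modulo the image of [i], so it
   inverts [B (x) q] modulo the image of [B (x) i]. *)
Lemma tensor_right_exact B M' M M'' (i : {linear M' -> M}) (q : {linear M -> M''}) :
  (forall m, q m = 0 -> exists m', i m' = m) -> (forall m'', exists m, q m = m'') ->
  forall x, tensor_map (idfun : {linear B -> B}) q x = 0 ->
    exists y, tensor_map (idfun : {linear B -> B}) i y = x.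
Proof.
move=> iq /choice[s qs].
pose Im x := exists y, tensor_map (idfun : {linear B -> B}) i y = x.
have Im0 : Im 0 by exists 0; apply: raddf0.
have ImB x y : Im x -> Im y -> Im (x - y).
  by move=> [x' <-] [y' <-]; exists (x' - y'); rewrite raddfB.
have Im_tens b m : q m = 0 -> Im (tens b m).
  by move=> /iq[m' <-]; exists (tens b m'); rewrite tensor_map_tens.
pose sec (z : {freeg (B * M'')%type / int}) : {freeg (B * M)%type / int} :=
  fglift (fun p => freeg_pair p.1 (s p.2)) z.
have secB z z' : sec (z - z') = sec z - sec z' by exact: lift_is_additive.
have sec0 : sec 0 = 0 by rewrite -(subrr 0) secB subrr.
have secU b m : sec (freeg_pair b m) = freeg_pair b (s m).
  by rewrite /sec /freeg_pair liftU scale1r.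
have sec_rel z : z \in @tensor_rel R B M'' -> Im (tensor_proj (sec z)).
  elim/tensor_rel_ind: z / => [|z z' ? ?|_ [b b' m|b m m'|b r m]].
  - by rewrite sec0 tensor_proj0.
  - by rewrite secB tensor_projB; apply: ImB.
  - rewrite !secB !secU (_ : tensor_proj _ = 0) //.
    exact/tensor_proj_eq0/tensor_relator_rel/relator_addl.
  - rewrite !secB !secU !tensor_projB -!tensBr; apply: Im_tens.
    by rewrite !linearB /= !qs -addrA -opprD subrr.
  - rewrite secB !secU tensor_projB -/(tens _ _) tens_balanced -tensBr.
    by apply: Im_tens; rewrite linearB linearZ /= !qs subrr.
have sec_q x : Im (tensor_proj (sec (freeg_map (idfun : {linear B -> B}) q x)) - tensor_proj x).
  elim/freeg_ind: x => [|z z' Pz Pz'|[b m]].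
  - by rewrite raddf0 sec0 subrr.
  - rewrite raddfB secB !tensor_projB; have := ImB _ _ Pz Pz'.
    by rewrite !opprD !opprK addrACA.
  - rewrite freeg_map_pair secU -tensBr; apply: Im_tens.
    by rewrite linearB /= qs subrr.
move=> x; rewrite -[x]tensor_reprK tensor_map_proj => /tensor_proj_eq0/sec_rel Ims.
by move: (ImB _ _ Ims (sec_q (repr x))); rewrite opprB addrC subrK.
Qed.

End TensorMap.

(** * Pure subcomplexes *)

Section InducedMaps.
Variable R : pzRingType.
Implicit Types X Y : lmodType R.

Section Restrict.
Variables (X Y : lmodType R) (f : {linear X -> Y}) (U : submod X) (V : submod Y).
Hypothesis fUV : forall x, U x -> V (f x).

Definition restrict_fun (x : submod_type U) : submod_type V :=
  SubElement (introT (asboolP _) (fUV (incl_mem x))).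

Lemma restrict_fun_linear : linear restrict_fun.
Proof.
move=> a x y; apply: incl_inj; rewrite linearP.
exact: (linearP (f \o incl U)).
Qed.

Definition restrict : {linear submod_type U -> submod_type V} :=
  mk_linear restrict_fun_linear.

Lemma incl_restrict x : incl V (restrict x) = f (incl U x).
Proof. by []. Qed.

Definition induced_fun (x : quomod_type U) : quomod_type V := proj V (f (repr x)).

Lemma induced_fun_proj x : induced_fun (proj U x) = proj V (f x).
Proof.
apply/proj_eq; rewrite -linearB; apply/fUV/proj_eq.
exact: proj_fun_repr.
Qed.

Lemma induced_fun_linear : linear induced_fun.
Proof.
move=> a y z; have [[x <-] [x' <-]] := (proj_surj y, proj_surj z).
by rewrite -linearP !induced_fun_proj !linearP.
Qed.

Definition induced : {linear quomod_type U -> quomod_type V} :=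
  mk_linear induced_fun_linear.

Lemma induced_proj x : induced (proj U x) = proj V (f x).
Proof. exact: induced_fun_proj. Qed.

End Restrict.

Definition inclusion X (U V : submod X) (UV : forall x, U x -> V x) :
  {linear submod_type U -> submod_type V} := restrict (f := idfun) UV.

Lemma incl_inclusion X (U V : submod X) (UV : forall x, U x -> V x) x :
  incl V (inclusion UV x) = incl U x.
Proof. by []. Qed.

End InducedMaps.

Arguments restrict {R X Y f U V} fUV : simpl never.
Arguments induced {R X Y f U V} fUV : simpl never.

Section Reflects.
Variable R : pzRingType.

(* The tensor condition for [delta = idfun] is purity of [i]; for a differential
   it says that boundaries in [B (x) X] coming from [Y] are boundaries in [B (x) Y]. *)
Definition reflects (X' X Y' Y : lmodType R) (i : {linear Y -> X})
    (delta : {linear X' -> X}) (deltaY : {linear Y' -> Y}) : Prop :=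
  (forall x y, delta x = i y -> exists y', deltaY y' = y) /\
  forall (B' B : lmodType R^c) (h : {linear B' -> B}) x w,
    tensor_map h delta x = tensor_map (idfun : {linear B -> B}) i w ->
    exists w', tensor_map h deltaY w' = w.

Section ExactSubquotient.
Variables (B1 B0 B2 : lmodType R^c) (h1 : {linear B1 -> B0}) (h2 : {linear B0 -> B2}).
Variables (X1 X0 X2 : lmodType R).
Variables (d1 : {linear X1 -> X0}) (d2 : {linear X0 -> X2}).
Variables (U1 : submod X1) (U0 : submod X0) (U2 : submod X2).
Hypotheses (dU1 : forall x, U1 x -> U0 (d1 x)) (dU2 : forall x, U0 x -> U2 (d2 x)).

(** With identities for [d1] and [d2] this serves flatness, with identities for [h1] and [h2]
    acyclicity. The vanishing of the composite is assumed because [incl U2] may lose injectivity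
    under tensoring. *)
Lemma exact_at_sub :
  reflects (incl U0) d1 (restrict dU1) ->
  exact_at (tensor_map h1 d1) (tensor_map h2 d2) ->
  (forall w, tensor_map h2 (restrict dU2) (tensor_map h1 (restrict dU1) w) = 0) ->
  exact_at (tensor_map h1 (restrict dU1)) (tensor_map h2 (restrict dU2)).
Proof.
move=> [_ refl] ex zero y; split=> [y0|[x <-]]; last exact: zero.
have [|x xy] := (ex (tensor_map idfun (incl U0) y)).1; last exact: refl xy.
rewrite (@tensor_map_square _ _ _ _ _ _ _ _ _ idfun h2 h2 idfun _ _
  (restrict dU2) (incl U2)) //.
by rewrite y0 raddf0.
Qed.

(** Diagram chase: a cycle y lifts to y' over [X0], and the image of y' comes from [U2] by right
    exactness. Reflection makes it the image of some w' over [U0], so y' - w' is a cycle over [X0],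
    hence a boundary, and it still represents y. *)
Lemma exact_at_quo :
  reflects (incl U2) d2 (restrict dU2) ->
  exact_at (tensor_map h1 d1) (tensor_map h2 d2) ->
  exact_at (tensor_map h1 (induced dU1)) (tensor_map h2 (induced dU2)).
Proof.
move=> [_ refl] ex y.
split=> [y0|[x <-]].
  have [y' y'E] := tensor_map_surj (@proj_surj R X0 U0) y.
  have [w wE] : exists w, tensor_map idfun (incl U2) w = tensor_map h2 d2 y'.
    apply: (@tensor_right_exact _ _ _ _ _ _ (proj U2)) => [m|m''|].
    - by move/proj_eq0/inclP.
    - exact: proj_surj.
    rewrite (@tensor_map_square _ _ _ _ _ _ _ _ _ h2 idfun idfun h2 _ _
      (proj U0) (induced dU2)) // => [|m]; last by rewrite induced_proj.
    by rewrite y'E y0.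
  have [w' w'E] := refl _ _ _ _ _ (esym wE).
  have [|z zE] := (ex (y' - tensor_map idfun (incl U0) w')).1.
    rewrite raddfB /= -wE -w'E; apply/eqP; rewrite subr_eq0; apply/eqP.
    exact: tensor_map_square.
  exists (tensor_map idfun (proj U1) z).
  rewrite (@tensor_map_square _ _ _ _ _ _ _ _ _ idfun h1 h1 idfun _ _ d1 (proj U0)) //;
    last by move=> m; rewrite induced_proj.
  rewrite zE raddfB /= y'E (@tensor_map_comp _ _ _ _ _ _ _ _ _ _ _ idfun \0) //.
    by rewrite (@tensor_map0 _ _ _ _ _ _ \0) // subr0.
  exact: proj_incl.
have [z <-] := tensor_map_surj (@proj_surj R X1 U1) x.
rewrite (@tensor_map_square _ _ _ _ _ _ _ _ _ idfun h1 h1 idfun _ _ d1 (proj U0)) //;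
  last by move=> m; rewrite induced_proj.
rewrite (@tensor_map_square _ _ _ _ _ _ _ _ _ idfun h2 h2 idfun _ _ d2 (proj U2)) //;
  last by move=> m; rewrite induced_proj.
by rewrite (ex _).2 ?raddf0 //; exists z.
Qed.

End ExactSubquotient.
End Reflects.

Lemma exact_at_ext (A B C : zmodType) (f f' : A -> B) (g g' : B -> C) :
  f =1 f' -> g =1 g' -> exact_at f g -> exact_at f' g'.
Proof. by move=> /funext <- /funext <-. Qed.

Section Subcomplexes.
Variables (R : pzRingType) (X : complex R).

Record subcomplex := Subcomplex {
  subcomplex_submod :> forall n, submod (X n);
  subcomplex_diff : forall n x,
    subcomplex_submod (n + 1) x -> subcomplex_submod n (diff X n x) }.

Implicit Types U V : subcomplex.

Definition sub_diff U n := restrict (@subcomplex_diff U n).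
Definition quo_diff U n := induced (@subcomplex_diff U n).

Lemma sub_diffK U n x : sub_diff U n (sub_diff U (n + 1) x) = 0.
Proof. by apply: incl_inj; rewrite !incl_restrict diffK linear0. Qed.

Lemma quo_diffK U n x : quo_diff U n (quo_diff U (n + 1) x) = 0.
Proof.
by have [y <-] := proj_surj x; rewrite !induced_proj diffK linear0.
Qed.

Definition sub_complex U : complex R :=
  @Complex R (fun n => submod_type (U n)) (sub_diff U) (@sub_diffK U).
Definition quo_complex U : complex R :=
  @Complex R (fun n => quomod_type (U n)) (quo_diff U) (@quo_diffK U).

Definition pure U : Prop := forall n,
  reflects (incl (U n)) idfun (inclusion (fun x (Ux : U n x) => Ux)) /\
  reflects (incl (U n)) (diff X n) (sub_diff U n).

Variable Bc : lmodType R^c -> Prop.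

Definition good (Y : complex R) : Prop :=
  [/\ forall n, flat (Y n), exact_complex Y & acyclic Bc Y].

Lemma good_sub U : good X -> pure U -> good (sub_complex U).
Proof.
move=> [Xflat Xex Xac] Upure; split=> [n B1 B0 B2 h1 h2 ex|n y|B BcB n].
(* The restriction of the identity is only pointwise equal to the identity of the submodule, hence
   the detour through [exact_at_ext]. *)
- have inc1 : inclusion (fun x (Ux : U n x) => Ux) =1 idfun.
    by move=> x; apply: incl_inj.
  apply: exact_at_ext (tensor_map_eq (frefl _) inc1) (tensor_map_eq (frefl _) inc1) _.
  apply: exact_at_sub => //; first by have [] := Upure n.
    exact: Xflat.
  move=> w; rewrite (@tensor_map_comp _ _ _ _ _ _ _ _ _ _ _ \0 idfun) //.
  - by apply: tensor_map0l.
  - by move=> b /=; apply/ex; exists b.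
  - by move=> m; apply: incl_inj.
- split=> [y0|[x <-]]; last exact: diffK.
  have [|x xy] := (Xex n (incl _ y)).1.
    by rewrite -[diff X n _]/(incl (U n) (sub_diff U n y)) [sub_diff U n y]y0 linear0.
  by have [_ [refl _]] := Upure (n + 1); apply: refl xy.
- apply: exact_at_sub; first by have [] := Upure (n + 1).
    exact: Xac.
  move=> w; rewrite (@tensor_map_comp _ _ _ _ _ _ _ _ _ _ _ idfun \0) //.
    exact: tensor_map0.
  exact: sub_diffK.
Qed.

Lemma good_quo U : good X -> pure U -> good (quo_complex U).
Proof.
move=> [Xflat Xex Xac] Upure; split=> [n B1 B0 B2 h1 h2 ex|n y|B BcB n].
- have ind1 : induced (fun x (Ux : U n x) => Ux : U n (idfun x)) =1 idfun.
    by move=> x; have [y <-] := proj_surj x; rewrite induced_proj.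
  apply: exact_at_ext (tensor_map_eq (frefl _) ind1) (tensor_map_eq (frefl _) ind1) _.
  apply: exact_at_quo => //; first by have [] := Upure n.
  exact: Xflat.
- split=> [y0|[x <-]]; last exact: diffK.
  have [x xE] := proj_surj y; subst y.
  have /proj_eq0/inclP[u uE] : proj (U n) (diff X n x) = 0.
    by rewrite -(induced_proj (@subcomplex_diff U n)).
  have [_ [/(_ _ _ (esym uE))[u' u'E] _]] := Upure n.
  have [|z zE] := (Xex n (x - incl _ u')).1.
    by rewrite linearB /= -uE -u'E subrr.
  exists (proj _ z); rewrite [LHS]induced_proj zE.
  by apply/proj_eq; rewrite addrAC subrr sub0r; apply/submodN/incl_mem.
- apply: exact_at_quo; first by have [] := Upure n.
  exact: Xac.
Qed.

End Subcomplexes.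

Section ReflectsConstructions.
Variable R : pzRingType.

Section Union.
Variables (X1 X0 : lmodType R) (delta : {linear X1 -> X0}).
Variables (J : Type) (V1 : J -> submod X1) (V0 : J -> submod X0).
Variables (U1 : submod X1) (U0 : submod X0).
Hypotheses (dV : forall j x, V1 j x -> V0 j (delta x))
  (dU : forall x, U1 x -> U0 (delta x)).
Hypotheses (VU1 : forall j x, V1 j x -> U1 x) (VU0 : forall j x, V0 j x -> U0 x).
Hypotheses (UV0 : forall x, U0 x -> exists j, V0 j x) (J_inh : inhabited J).
Hypothesis V0_directed : forall i j, exists k,
  (forall x, V0 i x -> V0 k x) /\ (forall x, V0 j x -> V0 k x).

(** A tensor involves finitely many elements of the union, and by directedness these lie in one
    stage. *)
Lemma tensor_union (B : lmodType R^c) (w : tensor B (submod_type U0)) :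
  exists j w', tensor_map (idfun : {linear B -> B}) (inclusion (@VU0 j)) w' = w.
Proof.
elim/tensor_ind: w => [|x y [i [x' <-]] [j [y' <-]]|b m].
- by have [j] := J_inh; exists j, 0; apply: raddf0.
- have [k [ik jk]] := V0_directed i j.
  exists k, (tensor_map idfun (inclusion ik) x' - tensor_map idfun (inclusion jk) y').
  rewrite raddfB /=.
  rewrite (@tensor_map_comp _ _ _ _ _ _ _ _ _ _ _ idfun (inclusion (@VU0 i))) //;
    last by move=> m; apply: incl_inj.
  rewrite (@tensor_map_comp _ _ _ _ _ _ _ _ _ _ _ idfun (inclusion (@VU0 j))) //.
  by move=> m; apply: incl_inj.
- have [j /inclP[m' mE]] := UV0 (incl_mem m).
  exists j, (tens b m'); rewrite tensor_map_tens; congr tens.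
  exact: incl_inj.
Qed.

Lemma reflects_union :
  (forall j, reflects (incl (V0 j)) delta (restrict (@dV j))) ->
  reflects (incl U0) delta (restrict dU).
Proof.
move=> refl; split=> [x y xy|B' B h x w xw].
  have [j /inclP[y' y'E]] := UV0 (incl_mem y).
  have [|x' x'E] := (refl j).1 x y'; first by rewrite xy y'E.
  exists (inclusion (@VU1 j) x'); apply: incl_inj; rewrite -y'E -x'E.
  by rewrite incl_restrict incl_inclusion incl_restrict.
have [j [w' w'E]] := tensor_union w.
have [|x' x'E] := (refl j).2 _ _ h x w'.
  rewrite xw -w'E (@tensor_map_comp _ _ _ _ _ _ _ _ _ _ _ idfun (incl (V0 j))) //.
exists (tensor_map idfun (inclusion (@VU1 j)) x'); rewrite -w'E -x'E.
by apply: tensor_map_square => // m; apply: incl_inj.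
Qed.

End Union.

Section Preimage.
Variables (X1 X0 : lmodType R) (delta : {linear X1 -> X0}).
Variables (P1 : submod X1) (P0 : submod X0).
Hypothesis dP : forall x, P1 x -> P0 (delta x).
Variables (Q1 : submod (quomod_type P1)) (Q0 : submod (quomod_type P0)).
Hypothesis dQ : forall x, Q1 x -> Q0 (induced dP x).
Hypothesis dZ : forall x,
  submod_preimage (proj P1) Q1 x -> submod_preimage (proj P0) Q0 (delta x).

Let Z (X : lmodType R) (P : submod X) (Q : submod (quomod_type P)) :=
  submod_preimage (proj P) Q.

Let P_sub_Z (X : lmodType R) (P : submod X) (Q : submod (quomod_type P)) x :
  P x -> Z Q x.
Proof. by move=> /proj_eq0 Px; rewrite /Z submod_preimageE Px; apply: submod0. Qed.

Let Z_to_Q (X : lmodType R) (P : submod X) (Q : submod (quomod_type P)) :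
    {linear submod_type (Z Q) -> submod_type Q} :=
  restrict (fun x (Zx : Z Q x) => Zx : Q (proj P x)).

Let Z_to_Q_surj (X : lmodType R) (P : submod X) (Q : submod (quomod_type P)) y :
  exists x, @Z_to_Q X P Q x = y.
Proof.
have [x xE] := proj_surj (incl Q y).
have /inclP[z zE] : Z Q x by rewrite /Z submod_preimageE xE; apply: incl_mem.
by exists z; apply: incl_inj; rewrite incl_restrict zE.
Qed.

Let Z_to_Q_ker (X : lmodType R) (P : submod X) (Q : submod (quomod_type P)) x :
  @Z_to_Q X P Q x = 0 -> exists p, inclusion (@P_sub_Z X P Q) p = x.
Proof.
move=> /(congr1 (incl Q)); rewrite incl_restrict linear0 => /proj_eq0/inclP[p pE].
by exists p; apply: incl_inj.
Qed.

(** Solve the equation modulo P inside Q and lift the solution. The remaining error vanishes in Q,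
    so by right exactness it comes from P, where the reflection hypothesis on P removes it. *)
Lemma reflects_preimage :
  reflects (incl P0) delta (restrict dP) ->
  reflects (incl Q0) (induced dP) (restrict dQ) ->
  reflects (incl (submod_preimage (proj P0) Q0)) delta (restrict dZ).
Proof.
have dZQ m : restrict dQ (Z_to_Q Q1 m) = Z_to_Q Q0 (restrict dZ m).
  by apply: incl_inj; rewrite !incl_restrict induced_proj.
move=> reflP reflQ; split=> [x y xy|B' B h x w xw].
  have [|q qE] := reflQ.1 (proj P1 x) (Z_to_Q Q0 y).
    by rewrite induced_proj xy incl_restrict.
  have [z zE] := Z_to_Q_surj q; subst q.
  have [|p pE] := @Z_to_Q_ker _ _ _ (y - restrict dZ z).
    by rewrite linearB; apply/eqP; rewrite subr_eq0 -[Z_to_Q _ y]qE; apply/eqP/dZQ.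
  have [|p' p'E] := reflP.1 (x - incl _ z) p.
    rewrite -(incl_inclusion (@P_sub_Z X0 P0 Q0)) pE !linearB xy.
    by [].
  exists (inclusion (@P_sub_Z X1 P1 Q1) p' + z); apply: incl_inj.
  have := congr1 (incl _) pE; rewrite incl_inclusion -p'E incl_restrict linearB.
  move=> /(congr1 (+%R^~ (incl _ (restrict dZ z)))); rewrite subrK => <-.
  by rewrite !incl_restrict !linearD.
have [|q qE] := reflQ.2 _ _ h (tensor_map idfun (proj P1) x) (tensor_map idfun (Z_to_Q Q0) w).
  rewrite (@tensor_map_square _ _ _ _ _ _ _ _ _ idfun h h idfun _ _ delta (proj P0)) //;
    last by move=> m; rewrite induced_proj.
  by rewrite xw; apply: tensor_map_square => // m; rewrite incl_restrict.
have [z zE] := tensor_map_surj (@Z_to_Q_surj _ _ _) q; subst q.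
have [|||p pE] := @tensor_right_exact _ B _ _ _ (inclusion (@P_sub_Z X0 P0 Q0))
    (Z_to_Q Q0) _ _ (w - tensor_map h (restrict dZ) z).
- exact: Z_to_Q_ker.
- exact: Z_to_Q_surj.
- rewrite raddfB /= -qE (@tensor_map_square _ _ _ _ _ _ _ _ _ h idfun idfun h _ _
    (Z_to_Q Q1) (restrict dQ)) ?subrr // => m.
  by rewrite dZQ.
have [|p' p'E] := reflP.2 _ _ h (x - tensor_map idfun (incl _) z) p.
  rewrite raddfB /= xw.
  rewrite (@tensor_map_square _ _ _ _ _ _ _ _ _ idfun h h idfun _ _ (restrict dZ)
    (incl (Z Q0))) // -raddfB /= -pE.
  by rewrite (@tensor_map_comp _ _ _ _ _ _ _ _ _ _ _ idfun (incl P0)).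
exists (tensor_map idfun (inclusion (@P_sub_Z X1 P1 Q1)) p' + z).
rewrite raddfD /= (@tensor_map_square _ _ _ _ _ _ _ _ _ idfun h h idfun _ _
  (restrict dP) (inclusion (@P_sub_Z X0 P0 Q0))) //; last by move=> m; apply: incl_inj.
by rewrite p'E pE subrK.
Qed.

End Preimage.

(** A solution in Y is pushed to D along [p1]; the compatibility with [p0], which retracts Y0 onto
    D0, shows that it solves the original equation. *)
Lemma reflects_summand (X1 X0 Y1 Y0 D1 D0 : lmodType R) (i : {linear Y0 -> X0})
    (j : {linear D0 -> Y0}) (ij : {linear D0 -> X0})
    (p0 : {linear Y0 -> D0}) (p1 : {linear Y1 -> D1})
    (delta : {linear X1 -> X0}) (deltaY : {linear Y1 -> Y0}) (deltaD : {linear D1 -> D0}) :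
  (forall x, ij x = i (j x)) -> (forall x, p0 (j x) = x) ->
  (forall y, p0 (deltaY y) = deltaD (p1 y)) ->
  reflects i delta deltaY -> reflects ij delta deltaD.
Proof.
move=> ijE p0j p_delta [refl reflt]; split=> [x y xy|B' B h x w xw].
  have [|y' y'E] := refl x (j y); first by rewrite xy ijE.
  by exists (p1 y'); rewrite -p_delta y'E p0j.
have [|w' w'E] := reflt _ _ h x (tensor_map idfun j w).
  by rewrite xw (@tensor_map_comp _ _ _ _ _ _ _ _ _ _ _ idfun ij).
exists (tensor_map idfun p1 w').
rewrite (@tensor_map_square _ _ _ _ _ _ _ _ _ idfun h h idfun _ _ deltaY p0) //.
rewrite w'E (@tensor_map_comp _ _ _ _ _ _ _ _ _ _ _ idfun idfun) //.
exact: tensor_map_id.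
Qed.

End ReflectsConstructions.

Lemma reflects_ext (R : pzRingType) (X' X Y' Y : lmodType R) (i : {linear Y -> X})
    (delta delta' : {linear X' -> X}) (deltaY deltaY' : {linear Y' -> Y}) :
  delta =1 delta' -> deltaY =1 deltaY' ->
  reflects i delta deltaY -> reflects i delta' deltaY'.
Proof.
move=> dd' ddY' [refl reflt]; split=> [x y|B' B h x w].
  by rewrite -dd' => /refl[y' <-]; exists y'; rewrite ddY'.
rewrite -(tensor_map_eq (frefl h) dd') => /reflt[w' <-].
by exists w'; apply: tensor_map_eq.
Qed.

Section PureSubcomplexes.
Variables (R : pzRingType) (X : complex R).
Implicit Types U V P : subcomplex X.

Definition subcomplex_le U V := forall n x, U n x -> V n x.

Section Union.
Variables (J : Type) (V : J -> subcomplex X).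
Hypothesis J_inh : inhabited J.
Hypothesis V_directed : forall i j, exists k,
  subcomplex_le (V i) (V k) /\ subcomplex_le (V j) (V k).

Definition union_submod n : submod (X n).
Proof.
exists (fun x => exists j, V j n x) => [|a x y [i Vx] [j Vy]].
  by have [j] := J_inh; exists j; apply: submod0.
have [k [ik jk]] := V_directed i j.
by exists k; apply: submodP; [apply: ik|apply: jk].
Defined.

Lemma union_diff n x : union_submod (n + 1) x -> union_submod n (diff X n x).
Proof. by move=> [j Vx]; exists j; apply: subcomplex_diff. Qed.

Definition union_subcomplex : subcomplex X := Subcomplex union_diff.

Lemma pure_union : (forall j, pure (V j)) -> pure union_subcomplex.
Proof.
have dir n i j : exists k,
    (forall x, V i n x -> V k n x) /\ (forall x, V j n x -> V k n x).
  by have [k [ik jk]] := V_directed i j; exists k; split=> x; [apply: ik|apply: jk].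
move=> Vpure n; split.
  apply: (@reflects_union _ _ _ idfun J (fun j => V j n) (fun j => V j n) _ _
    (fun j x Vx => Vx)) => // [j x Vx|j|j]; try by exists j.
  by have [] := Vpure j n.
apply: (@reflects_union _ _ _ (diff X n) J (fun j => V j (n + 1)) (fun j => V j n) _ _
  (fun j => @subcomplex_diff _ _ (V j) n)) => // [j x Vx|j x Vx|j]; try by exists j.
by have [] := Vpure j n.
Qed.

End Union.

Definition zero_subcomplex : subcomplex X.
Proof.
by exists (fun n => zero_submod (X n)) => n x /= ->; apply: linear0.
Defined.

Lemma pure_zero : pure zero_subcomplex.
Proof.
have refl0 (X' Y Z : lmodType R) (delta : {linear X' -> Z}) (d : {linear Y -> _}) :
    reflects (incl (zero_submod Z)) delta d.
  have zero y : y = 0 :> submod_type (zero_submod Z).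
    by apply: incl_inj; rewrite linear0; apply: (incl_mem y).
  split=> [x y _|B' B h x w _]; first by exists 0; rewrite linear0 [y]zero.
  (* The identity of the zero module is the zero map, so [w] is zero. *)
  by exists 0; rewrite raddf0 -[w](@tensor_map_id _ _ _ idfun idfun) ?tensor_map0.
by move=> n; split; apply: refl0.
Qed.

Lemma maximal_pure (L : forall n, X n -> Prop) : (forall n, L n 0) ->
  exists P, [/\ pure P, forall n x, P n x -> L n x &
    forall P', pure P' -> (forall n x, P' n x -> L n x) ->
      subcomplex_le P P' -> subcomplex_le P' P].
Proof.
move=> L0; pose T := {P | pure P /\ forall n x, P n x -> L n x}.
have zeroP : pure zero_subcomplex /\ forall n x, zero_subcomplex n x -> L n x.
  by split=> [|n x /= ->]; [apply: pure_zero|apply: L0].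
pose zeroT : T := exist _ _ zeroP.
pose r (P Q : T) := `[< subcomplex_le (sval P) (sval Q) >].
have [|P Q S /asboolP PQ /asboolP QS|A Atot|[P [Ppure PL]] /= Pmax] :=
    @ZL_preorder T zeroT r.
- by move=> P; apply/asboolP.
- by apply/asboolP => n x /PQ/QS.
- have [[P0 AP0]|Aempty] := pselect (exists P : T, A P); last first.
    by exists zeroT => P AP; case: Aempty; exists P.
  pose V (j : {P : T | A P}) := sval (sval j).
  have V_inh : inhabited {P : T | A P} by split; exists P0.
  have V_dir i j : exists k, subcomplex_le (V i) (V k) /\ subcomplex_le (V j) (V k).
    case: i j => [P AP] [Q AQ].
    have [/asboolP PQ|/asboolP QP] := Atot _ _ AP AQ.
      by exists (exist _ Q AQ); split=> // n x.
    by exists (exist _ P AP); split=> // n x.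
  have unionP : pure (union_subcomplex V_inh V_dir) /\
      forall n x, union_subcomplex V_inh V_dir n x -> L n x.
    split=> [|n x [j]]; first by apply: pure_union => j; have [] := svalP (sval j).
    by have [_] := svalP (sval j); apply.
  pose unionT : T := exist _ _ unionP.
  exists unionT => P AP; apply/asboolP => n x Px.
  by exists (exist _ P AP).
exists P; split=> // P' P'pure P'L PP'.
have P'P : pure P' /\ forall n x, P' n x -> L n x by [].
pose T' : T := exist _ _ P'P.
by have /asboolP := Pmax T' (introT (asboolP _) PP').
Qed.

Section Preimage.
Variables (P : subcomplex X) (Q : subcomplex (quo_complex P)).

Definition quo_preimage : subcomplex X.
Proof.
exists (fun n => submod_preimage (proj (P n)) (Q n)) => n x.
rewrite !submod_preimageE => Qx.
have := @subcomplex_diff _ _ Q n _ Qx.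
by rewrite [diff (quo_complex P) n _]induced_proj.
Defined.

Lemma quo_preimageE n x : quo_preimage n x = Q n (proj (P n) x).
Proof. by []. Qed.

Lemma pure_preimage : pure P -> pure Q -> pure quo_preimage.
Proof.
move=> Ppure Qpure n; split.
  have indE : idfun =1 induced (fun x (Px : P n x) => Px : P n (idfun x)).
    by move=> x; have [y <-] := proj_surj x; rewrite induced_proj.
  have dQ x : Q n x -> Q n (induced (fun x (Px : P n x) => Px : P n (idfun x)) x).
    by rewrite -indE.
  apply: (@reflects_preimage _ _ _ idfun (P n) (P n) _ (Q n) (Q n) dQ).
    by have [] := Ppure n.
  apply: reflects_ext (Qpure n).1 => // x; apply: incl_inj.
  exact: indE.
have [_ reflP] := Ppure n; have [_ reflQ] := Qpure n.
exact: reflects_preimage reflP reflQ.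
Qed.

End Preimage.
End PureSubcomplexes.

(** * Pure hulls *)

Section FreegAlong.
Variables (R : pzRingType) (B : lmodType R^c) (X Y : lmodType R) (s : X -> Y).

Definition freeg_along (z : {freeg (B * X)%type / int}) : {freeg (B * Y)%type / int} :=
  fglift (fun p => freeg_pair p.1 (s p.2)) z.

Lemma freeg_alongB z z' : freeg_along (z - z') = freeg_along z - freeg_along z'.
Proof. exact: lift_is_additive. Qed.

Lemma freeg_along0 : freeg_along 0 = 0.
Proof. by rewrite -(subrr 0) freeg_alongB subrr. Qed.

Lemma freeg_along_pair b x : freeg_along (freeg_pair b x) = freeg_pair b (s x).
Proof. by rewrite /freeg_along /freeg_pair liftU scale1r. Qed.

End FreegAlong.

Section PartialMaps.
Variable R : pzRingType.
Implicit Types X Y : lmodType R.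

Definition partially_linear X Y (A : X -> Prop) (s : X -> Y) : Prop :=
  (forall x y, A x -> A y -> A (x + y) -> s (x + y) = s x + s y) /\
  (forall r x, A x -> A (r *: x) -> s (r *: x) = r *: s x).

Lemma partially_linear_sub X Y (A A' : X -> Prop) (s : X -> Y) :
  (forall x, A x -> A' x) -> partially_linear A' s -> partially_linear A s.
Proof. by move=> AA' [sD sZ]; split=> *; [apply: sD|apply: sZ]; apply: AA'. Qed.

(* A relation in a tensor product involves finitely many elements, so any map
   which is linear on these transports it. *)
Lemma tensor_rel_finite (B : lmodType R^c) X (z : {freeg (B * X)%type / int}) :
  z \in @tensor_rel R B X -> exists l : seq X, forall Y (s : X -> Y),
    partially_linear (fun x => List.In x l) s -> freeg_along s z \in @tensor_rel R B Y.
Proof.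
elim/tensor_rel_ind: z / => [|z z' [l lP] [l' l'P]|_ [b b' m|b m m'|b r m]].
- by exists [::] => Y s _; rewrite freeg_along0 rpred0.
- exists (l ++ l') => Y s s_lin; rewrite freeg_alongB rpredB //.
    by apply: lP; apply: partially_linear_sub s_lin => x xl; apply/List.in_or_app; left.
  by apply: l'P; apply: partially_linear_sub s_lin => x xl; apply/List.in_or_app; right.
- exists [::] => Y s _; rewrite !freeg_alongB !freeg_along_pair.
  exact/tensor_relator_rel/relator_addl.
- exists [:: m; m'; m + m'] => Y s [sD _].
  rewrite !freeg_alongB !freeg_along_pair sD /=; try by intuition.
  exact/tensor_relator_rel/relator_addr.
- exists [:: m; r *: m] => Y s [_ sZ].
  rewrite !freeg_alongB !freeg_along_pair sZ /=; try by intuition.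
  exact/tensor_relator_rel/relator_bal.
Qed.

Section Reflects.
Variables (X1 X0 : lmodType R) (delta : {linear X1 -> X0}).
Variables (U1 : submod X1) (U0 : submod X0).
Hypothesis dU : forall x, U1 x -> U0 (delta x).
Hypothesis partial : forall (l1 : seq X1) (l0 : seq X0),
  exists (r1 : X1 -> X1) (r0 : X0 -> X0),
  [/\ partially_linear (fun x => List.In x l0) r0,
      forall x, List.In x l0 -> U0 (r0 x),
      forall x, List.In x l0 -> U0 x -> r0 x = x,
      forall x, List.In x l1 -> U1 (r1 x) &
      forall x, List.In x l1 -> List.In (delta x) l0 -> r0 (delta x) = delta (r1 x)].

Let corestrict (X : lmodType R) (U : submod X) (r : X -> X) :
  exists s : X -> submod_type U, forall x, U (r x) -> incl U (s x) = r x.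
Proof.
have /choice[s sE] x : exists y : submod_type U, U (r x) -> incl U y = r x.
  have [/inclP[y yE]|nU] := pselect (U (r x)); first by exists y.
  by exists 0.
by exists s.
Qed.

(** On representatives, an equation between tensors involves finitely many elements. Maps that send
    these into U, preserve the relations among them and fix those already in U0 turn the equation in
    X into one in U. *)
Lemma reflects_partial : reflects (incl U0) delta (restrict dU).
Proof.
split=> [x y xy|B' B h x w xw].
  have [r1 [r0 [_ _ r0id /= r1U rd]]] := partial [:: x] [:: delta x].
  have /inclP[x' x'E] := r1U x (or_introl erefl).
  exists x'; apply: incl_inj; rewrite incl_restrict x'E -rd; try by left.
  by rewrite r0id ?xy; [|left|apply: incl_mem].
(* Three finite lists are collected: [l] for the relations that witness the equation, [l1] for the
   elements at which the maps must commute with [delta], and [l0] for the elements of [U0] that must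
   stay fixed. *)
have [l lP] : exists l : seq X0, forall Y (s : X0 -> Y),
    partially_linear (fun x => List.In x l) s ->
    freeg_along s (freeg_map h delta (repr x) -
      freeg_map (idfun : {linear B -> B}) (incl U0) (repr w)) \in @tensor_rel R B Y.
  by apply/tensor_rel_finite/tensor_projP; rewrite -!tensor_map_proj !tensor_reprK.
have [l1 l1P] : exists l1 : seq X1, forall (s1 : X1 -> submod_type U1)
    (s0 : X0 -> submod_type U0),
    (forall x, List.In x l1 -> s0 (delta x) = restrict dU (s1 x)) ->
    freeg_along s0 (freeg_map h delta (repr x)) =
    freeg_map h (restrict dU) (freeg_along s1 (repr x)).
  elim/freeg_ind: (repr x) => [|z z' [k kP] [k' k'P]|[b m]].
  - by exists [::] => s1 s0 _; rewrite freeg_along0 !raddf0 freeg_along0.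
  - exists (k ++ k') => s1 s0 ss; rewrite freeg_alongB !raddfB freeg_alongB.
    rewrite /= (kP s1) 1?(k'P s1) // => u uk; apply/ss/List.in_or_app.
      by right.
    by left.
  - exists [:: m] => s1 s0 ss; rewrite freeg_map_pair !freeg_along_pair ss /=; last by left.
    by rewrite freeg_map_pair.
have [l0 l0P] : exists l0 : seq X0, (forall u, List.In u l0 -> U0 u) /\
    forall s0 : X0 -> submod_type U0,
    (forall y, List.In (incl U0 y) l0 -> s0 (incl U0 y) = y) ->
    freeg_along s0 (freeg_map (idfun : {linear B -> B}) (incl U0) (repr w)) = repr w.
  elim/freeg_ind: (repr w) => [|z z' [k [kU kP]] [k' [k'U k'P]]|[b m]].
  - by exists [::]; split=> // s0 _; rewrite raddf0 freeg_along0.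
  - exists (k ++ k'); split=> [u uk|s0 ss].
      by have [/kU|/k'U] := List.in_app_or _ _ _ uk.
    rewrite raddfB freeg_alongB kP 1?k'P // => u uk; apply/ss/List.in_or_app.
      by right.
    by left.
  - exists [:: incl U0 m]; split=> [u [<-|[]]|s0 ss]; first exact: incl_mem.
    by rewrite freeg_map_pair freeg_along_pair ss //=; left.
have [r1 [r0 [r0lin r0U r0id r1U rd]]] := partial l1 (l ++ l0 ++ map delta l1).
have [s1 s1E] := corestrict U1 r1; have [s0 s0E] := corestrict U0 r0.
have in_l u : List.In u l -> List.In u (l ++ l0 ++ map delta l1).
  by move=> ul; apply/List.in_or_app; left.
have in_l0 u : List.In u l0 -> List.In u (l ++ l0 ++ map delta l1).
  by move=> ul; apply/List.in_or_app; right; apply/List.in_or_app; left.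
have in_l1 u : List.In u l1 -> List.In (delta u) (l ++ l0 ++ map delta l1).
  move=> ul; apply/List.in_or_app; right; apply/List.in_or_app; right.
  exact: List.in_map.
exists (tensor_proj (freeg_along s1 (repr x))).
rewrite tensor_map_proj -(l1P s1 s0) => [|u ul]; last first.
  apply: incl_inj; rewrite incl_restrict s0E ?s1E; first by apply: rd => //; apply: in_l1.
    exact: r1U.
  exact/r0U/in_l1.
rewrite -[RHS]tensor_reprK -[in RHS](l0P.2 s0) => [|y yl].
  apply/tensor_projP; rewrite -freeg_alongB; apply: lP; split=> [u v ul vl uvl|r u ul rul].
    have [] := (in_l _ ul, in_l _ vl, in_l _ uvl) => -[{}ul {}vl] {}uvl.
    by apply: incl_inj; rewrite linearD !s0E; [apply: r0lin.1|apply: r0U..].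
  have [{}ul {}rul] := (in_l _ ul, in_l _ rul).
  by apply: incl_inj; rewrite linearZ !s0E; [apply: r0lin.2|apply: r0U..].
have {}yl := in_l0 _ yl.
by apply: incl_inj; rewrite s0E; [apply: r0id|apply: r0U] => //; apply: incl_mem.
Qed.

End Reflects.
End PartialMaps.

Section HullOfComplex.
Variables (R : pzRingType) (X : complex R).

Definition homogeneous := {n : int & X n}.

Definition of_degree n (u : X n) : homogeneous := existT _ n u.

Lemma of_degree_inj n : injective (@of_degree n).
Proof.
move=> u v uv; have := projT2_eq uv.
by rewrite (eq_irrelevance (projT1_eq uv) erefl).
Qed.

Variant operation : Type := op_add | op_scale of R | op_diff.

(** Ternary relations on homogeneous elements fit the one-sorted signature of the hull. For scaling
    and the differential the third argument is a dummy. *)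
Definition op_rel (o : operation) (x y z : homogeneous) : Prop :=
  match o with
  | op_add => exists n (u v : X n),
      [/\ x = of_degree u, y = of_degree v & z = of_degree (u + v)]
  | op_scale r => exists n (u : X n), x = of_degree u /\ y = of_degree (r *: u)
  | op_diff => exists n (u : X (n + 1)), x = of_degree u /\ y = of_degree (diff X n u)
  end.

Lemma op_rel_add n (u v w : X n) :
  op_rel op_add (of_degree u) (of_degree v) (of_degree w) <-> w = u + v.
Proof.
split=> [[m [x [y [ux vy wxy]]]]|->]; last by exists n, u, v.
have mn := congr1 (@projT1 _ _) ux; move: mn ux vy wxy => /= mn; subst m.
by move=> /of_degree_inj-> /of_degree_inj-> /of_degree_inj->.
Qed.

Lemma op_rel_scale n r (u v : X n) t :
  op_rel (op_scale r) (of_degree u) (of_degree v) t <-> v = r *: u.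
Proof.
split=> [[m [x [ux vx]]]|->]; last by exists n, u.
have mn := congr1 (@projT1 _ _) ux; move: mn ux vx => /= mn; subst m.
by move=> /of_degree_inj-> /of_degree_inj->.
Qed.

Lemma op_rel_diff n (u : X (n + 1)) (v : X n) t :
  op_rel op_diff (of_degree u) (of_degree v) t <-> v = diff X n u.
Proof.
split=> [[m [x [ux vx]]]|->]; last by exists n, u.
have mn := congr1 (@projT1 _ _) vx; move: mn ux vx => /= mn; subst m.
by move=> /of_degree_inj-> /of_degree_inj->.
Qed.

Record absorbs (V : Type) (phi : forall n, X n -> V)
    (A S : forall n, X n -> Prop) (rho : forall n, X n -> X n) : Prop := Absorbs {
  absorbs_mem : forall n u, A n u -> S n (rho n u);
  absorbs_id : forall n u, A n u -> S n u -> rho n u = u;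
  absorbs_linear : forall n, partially_linear (A n) (rho n);
  absorbs_diff : forall n u, A (n + 1) u -> A n (diff X n u) ->
    rho n (diff X n u) = diff X n (rho (n + 1) u);
  absorbs_value : forall n u, A n u -> phi n (rho n u) = phi n u }.

(** Reflection of [L]-indexed families is stronger than purity, which it implies for suitable [L];
    it allows a whole subcomplex to be mapped into [S] at once. *)
Definition absorbing (L V : Type) (phi : forall n, X n -> V)
    (S : forall n, X n -> Prop) : Prop :=
  forall a : L -> homogeneous, exists rho,
    absorbs phi (fun n u => exists l, a l = of_degree u) S rho.

Section Bintree.
Variables (A0 : Type) (a0 : A0).
Local Notation L := (bintree A0).
Hypothesis RL : injects R L.

Lemma operation_injects : injects operation L.
Proof.
have [f f_inj] : injects (option (option R)) L.
  have [f f_inj] := RL.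
  exists (fun o => match o with
    | None => bin_leaf a0
    | Some None => bin_node (bin_leaf a0) (bin_leaf a0)
    | Some (Some r) => bin_node (bin_node (bin_leaf a0) (bin_leaf a0)) (f r) end).
  by move=> [[r|]|] [[r'|]|] //= [/f_inj->].
exists (fun o => match o with
  | op_add => f None | op_diff => f (Some None) | op_scale r => f (Some (Some r)) end).
by move=> [|r|] [|r'|] //= /f_inj // [->].
Qed.

Lemma absorbing_hull (V G : Type) (phi : forall n, X n -> V) (g : G -> homogeneous) (y0 : G) :
  injects V (L -> Prop) -> injects G (L -> Prop) ->
  exists S : forall n, X n -> Prop,
  [/\ covered (L -> Prop) (fun t : homogeneous => S (projT1 t) (projT2 t)),
      forall y, S _ (projT2 (g y)) & absorbing L phi S].
Proof.
(* The degree is recorded with the value, so that reflected elements keep their degree. *)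
move=> VK GK; pose f (t : homogeneous) : int * V := (projT1 t, phi _ (projT2 t)).
have VK' : injects (int * V) (L -> Prop).
  by apply: kappa_prod => //; apply/singleton_injects/countable_injects.
have [S [Scov Sg Srefl]] :=
  @reflective_hull _ a0 homogeneous _ _ _ y0 op_rel f g VK' operation_injects GK.
exists (fun n u => S (of_degree u)); split=> [|y|a].
- have [e eS] := Scov; exists e => -[n u] /eS //.
- by move: (Sg y); case: (g y).
have [b [bS bid brel bval]] := Srefl a.
have rex n (u : X n) : exists v : X n, (exists l, a l = of_degree u) ->
    exists2 l, a l = of_degree u & b l = of_degree v.
  have [[l lt]|nl] := pselect (exists l, a l = of_degree u); last by exists 0 => /nl.
  have := bval l; rewrite lt /f; case bl : (b l) => [m v] /= [mn _].
  by subst m; exists v => _; exists l.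
pose r n u := projT1 (cid (rex n u)).
have rP n u : (exists l, a l = of_degree u) ->
    exists2 l, a l = of_degree u & b l = of_degree (r n u) := projT2 (cid (rex n u)).
exists r; split=> [n u /rP[l _ <-]|n u /rP[l lu bl] Su|n|n u Au Adu|n u /rP[l lu bl]].
- exact: bS.
- by apply: of_degree_inj; rewrite -bl -lu; apply: bid; rewrite lu.
- split=> [u v Au Av Auv|c u Au Acu].
    have [[l1 l1u b1] [l2 l2v b2] [l3 l3w b3]] := And3 (rP _ _ Au) (rP _ _ Av) (rP _ _ Auv).
    apply/op_rel_add; rewrite -b1 -b2 -b3; apply: brel.
    by rewrite l1u l2v l3w; apply/op_rel_add.
  have [[l1 l1u b1] [l2 l2v b2]] := conj (rP _ _ Au) (rP _ _ Acu).
  apply/(op_rel_scale _ _ _ (b l2)); rewrite -b1 -b2; apply: brel.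
  by rewrite l1u l2v; apply/op_rel_scale.
- have [[l1 l1u b1] [l2 l2v b2]] := conj (rP _ _ Au) (rP _ _ Adu).
  apply/(op_rel_diff _ _ (b l2)); rewrite -b1 -b2; apply: brel.
  by rewrite l1u l2v; apply/op_rel_diff.
- have := bval l; rewrite lu bl /f /= => ruE.
  by have := congr1 snd ruE.
Qed.

(** Since [L] is infinite, finite lists are covered by [L]-indexed families. *)
Lemma finite_family (s : seq homogeneous) :
  exists a : L -> homogeneous, forall t, List.In t s -> exists l, a l = t.
Proof.
case: s => [|t0 s]; first by exists (fun=> of_degree (0 : X 0)).
have [a aP] := @covered_injects nat L homogeneous (fun t => List.In t (t0 :: s)) t0
  (fun k => List.nth k (t0 :: s) t0) (nat_injects a0)
  (fun t ts => let: ex_intro k (conj _ kt) := List.In_nth _ _ t0 ts in ex_intro _ k kt).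
by exists a => t ts; apply: aP.
Qed.

Section AbsorbingSubcomplex.
Variables (V : Type) (phi : forall n, X n -> V) (S : forall n, X n -> Prop).
Hypothesis Sabs : absorbing L phi S.

Lemma absorbs_finite (s : seq homogeneous) :
  exists rho, absorbs phi (fun n u => List.In (of_degree u) s) S rho.
Proof.
have [a aP] := finite_family s; have [rho [rS rid rlin rd rv]] := Sabs a.
exists rho; split=> [n u us|n u us|n|n u us dus|n u us].
- exact/rS/aP.
- exact/rid/aP.
- by apply: partially_linear_sub (rlin n) => u us; apply: aP.
- by apply: rd; apply: aP.
- exact/rv/aP.
Qed.

(** A map into [S] that fixes u and v and respects c u + v also fixes c u + v, which therefore lies
    in [S]. For 0, additivity forces the image of 0 to be 0. *)
Definition absorbing_submod n : submod (X n).
Proof.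
exists (@S n) => [|c u v Su Sv].
  have [rho [rS _ /(_ n)[rD _] _ _]] := absorbs_finite [:: of_degree (0 : X n)].
  have := rS n 0 (or_introl erefl); rewrite (_ : rho n 0 = 0) //.
  apply: (addrI (rho n 0)); rewrite addr0.
  by have := rD 0 0; rewrite addr0 => /(_ (or_introl erefl) (or_introl erefl)) <- //; left.
have [rho [rS rid /(_ n)[rD rZ] _ _]] := absorbs_finite
  [:: of_degree u; of_degree v; of_degree (c *: u); of_degree (c *: u + v)].
have /= := rS n (c *: u + v); rewrite rD /=; try by intuition.
rewrite rZ /=; try by intuition.
by rewrite !rid //=; intuition.
Defined.

Lemma absorbing_diff n x :
  absorbing_submod (n + 1) x -> absorbing_submod n (diff X n x).
Proof.
move=> Sx; have [rho [rS rid _ rd _]] :=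
  absorbs_finite [:: of_degree x; of_degree (diff X n x)].
have /= := rS n (diff X n x); rewrite rd /=; try by intuition.
by rewrite rid //=; intuition.
Qed.

Definition absorbing_subcomplex : subcomplex X := Subcomplex absorbing_diff.

Lemma pure_absorbing : pure absorbing_subcomplex.
Proof.
move=> n; split; apply: reflects_partial => l1 l0.
  have [rho [rS rid rlin _ _]] := absorbs_finite (map (@of_degree n) (l1 ++ l0)).
  have in0 x : List.In x l0 -> List.In (of_degree x) (map (@of_degree n) (l1 ++ l0)).
    by move=> xl; apply/List.in_map/List.in_or_app; right.
  have in1 x : List.In x l1 -> List.In (of_degree x) (map (@of_degree n) (l1 ++ l0)).
    by move=> xl; apply/List.in_map/List.in_or_app; left.
  exists (rho n), (rho n); split=> [|x /in0|x /in0|x /in1|//]; try exact: rS; try exact: rid.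
  exact: partially_linear_sub (rlin n).
have [rho [rS rid rlin rd _]] :=
  absorbs_finite (map (@of_degree (n + 1)) l1 ++ map (@of_degree n) l0).
have in0 x : List.In x l0 ->
    List.In (of_degree x) (map (@of_degree (n + 1)) l1 ++ map (@of_degree n) l0).
  by move=> xl; apply/List.in_or_app; right; apply/List.in_map.
have in1 x : List.In x l1 ->
    List.In (of_degree x) (map (@of_degree (n + 1)) l1 ++ map (@of_degree n) l0).
  by move=> xl; apply/List.in_or_app; left; apply/List.in_map.
exists (rho (n + 1)), (rho n); split=> [|x /in0|x /in0|x /in1|x /in1 x1 /in0 dx0].
- exact: partially_linear_sub (rlin n).
- exact: rS.
- exact: rid.
- exact: rS.
- exact: rd.
Qed.

End AbsorbingSubcomplex.
End Bintree.
End HullOfComplex.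

(** * Bounded pure quotients *)

Section PureHulls.
Variables (R : pzRingType).

Definition union_of (X : complex R) (U : subcomplex X) (t : homogeneous X) : Prop :=
  U (projT1 t) (projT2 t).

Lemma pure_hull (X : complex R) (A0 : Type) (a0 : A0) (V G : Type)
    (phi : forall n, X n -> V) (g : G -> homogeneous X) (y0 : G) :
  injects R (bintree A0) -> injects V (bintree A0 -> Prop) ->
  injects G (bintree A0 -> Prop) -> exists U : subcomplex X,
  [/\ pure U, covered (bintree A0 -> Prop) (union_of U), forall y, union_of U (g y) &
    absorbing (bintree A0) phi (fun n => U n)].
Proof.
move=> RL VK GK; have [S [Scov Sg Sabs]] := absorbing_hull a0 RL phi g y0 VK GK.
by exists (absorbing_subcomplex a0 Sabs); split=> //; apply: pure_absorbing.
Qed.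

(** Every scalar is an operation of the signature, so the index type must contain [R]. *)
Definition kappa0 : Type := bintree (R + nat) -> Prop.

Lemma ring_injects : injects R (bintree (R + nat)).
Proof.
by apply: injects_trans (@leaf_injects _); exists inl => x y [].
Qed.

Lemma small_pure_hull (X : complex R) (G : Type) (g : G -> homogeneous X) (y0 : G) :
  injects G kappa0 -> exists U : subcomplex X,
  [/\ pure U, covered kappa0 (union_of U) & forall y, union_of U (g y)].
Proof.
move=> GK; have a0 : R + nat := inr 0%N.
have [|U [Upure Ucov Ug _]] :=
    pure_hull a0 (fun n (_ : X n) => tt) g y0 ring_injects _ GK; last by exists U.
exact/singleton_injects/(countable_injects a0).
Qed.

Variable M : lmodType R.

(** The leaves contain [kappa0], so that a small pure hull can be enumerated by the index type, and
    [M], so that the values of [phi] embed in [kappa1]. *)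
Definition kappa1 : Type := bintree (kappa0 + M) -> Prop.

Lemma kappa0_injects : injects kappa0 (bintree (kappa0 + M)).
Proof. by apply: injects_trans (@leaf_injects _); exists inl => x y []. Qed.

Lemma ring_injects1 : injects R (bintree (kappa0 + M)).
Proof.
apply: injects_trans kappa0_injects; exact/singleton_injects/ring_injects.
Qed.

Lemma target_injects : injects M kappa1.
Proof.
apply/singleton_injects/injects_trans/leaf_injects.
by exists inr => x y [].
Qed.

Section NoPureKernel.
Variables (X : complex R) (phi : forall n, {linear X n -> M}).
Hypothesis no_pure : forall P : subcomplex X, pure P ->
  (forall n x, P n x -> phi n x = 0) -> forall n x, P n x -> x = 0.

Section Difference.
Variables (Y Y' S : subcomplex X) (rho : forall n, X n -> X n).
Hypotheses (Y'pure : pure Y') (YY' : subcomplex_le Y Y').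
Hypothesis Y'_sum : forall n x, Y' n x -> exists2 s, S n s & Y n (x - s).
Hypothesis rhoP : absorbs (fun n => phi n) (fun n => S n) (fun n => Y n) rho.

Lemma rho_linear n a x y : S n x -> S n y ->
  rho (a *: x + y) = a *: rho x + rho y.
Proof.
move=> Sx Sy; have [rD rZ] := absorbs_linear rhoP n.
rewrite rD ?rZ //; try exact: submodZ.
by apply: submodP.
Qed.

Definition difference_submod n : submod (X n).
Proof.
exists (fun d => exists s, [/\ S n s, Y' n s & d = s - rho s]) => [|a x y].
  exists 0; split; try exact: submod0.
  by rewrite (absorbs_id rhoP) ?subrr //; apply: submod0.
move=> [s [Ss Ys ->]] [t [St Yt ->]]; exists (a *: s + t); split; try exact: submodP.
by rewrite rho_linear // scalerBr opprD addrACA.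
Defined.

Lemma difference_diff n x :
  difference_submod (n + 1) x -> difference_submod n (diff X n x).
Proof.
move=> [s [Ss Ys ->]]; exists (diff X n s).
split; try exact: subcomplex_diff.
by rewrite linearB (absorbs_diff rhoP) //; apply: subcomplex_diff.
Qed.

Definition difference : subcomplex X := Subcomplex difference_diff.

Lemma difference_le : subcomplex_le difference Y'.
Proof.
move=> n _ [s [Ss Ys ->]]; apply: submodB => //.
exact/YY'/(absorbs_mem rhoP).
Qed.

(** This is the projection of [Y'] along [Y]: an element congruent to s modulo [Y] goes to s - rho
    s. It is well defined because [rho] fixes the elements of [S] that lie in [Y]. *)
Lemma difference_projection n :
  exists p : {linear submod_type (Y' n) -> submod_type (difference n)},
  forall y v, p y = v <->
    exists s, [/\ S n s, Y n (incl _ y - s) & incl _ v = s - rho s].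
Proof.
have [y|v [s [Ss]]|a y v y' v' [s [Ss Yys vE]] [s' [Ss' Yys' vE']]|p pP] :=
  @linear_of_relation _ _ _ (fun (y : submod_type (Y' n)) (v : submod_type (difference n)) =>
    exists s, [/\ S n s, Y n (incl _ y - s) & incl _ v = s - rho s]).
- have [s Ss Yys] := Y'_sum (incl_mem y).
  have Y's : Y' n s.
    by rewrite -[s](subKr (incl _ y)); apply: submodB (incl_mem y) (YY' Yys).
  have /inclP[v vE] : difference n (s - rho s) by exists s.
  by exists v, s.
- rewrite linear0 sub0r => /submodN; rewrite opprK => Ys vE.
  by apply: incl_inj; rewrite vE linear0 (absorbs_id rhoP) // subrr.
- exists (a *: s + s'); split; first exact: submodP.
    by rewrite linearP opprD addrACA -scalerBr; apply: submodP.
  by rewrite linearP vE vE' rho_linear // scalerBr opprD addrACA.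
by exists p => y v; split=> /pP.
Qed.

(** The difference is a direct summand of the pure [Y'], and the projections commute with the
    differentials because [rho] does. *)
Lemma pure_difference : pure difference.
Proof.
move=> n; have [p pP] := difference_projection n.
have [p' p'P] := difference_projection (n + 1).
have pj (x : submod_type (difference n)) : p (inclusion (@difference_le n) x) = x.
  apply/pP; have [s [Ss Ys xE]] := incl_mem x; exists s; split=> //.
  rewrite incl_inclusion xE addrAC subrr sub0r; apply: submodN.
  exact: absorbs_mem rhoP _ _ Ss.
have [refl refld] := Y'pure n; split.
  apply: reflects_summand pj _ refl => //.
  by move=> y; rewrite [inclusion _ y](_ : _ = y) ?[inclusion _ (p y)](_ : _ = p y) //;
    apply: incl_inj.
apply: (@reflects_summand _ _ _ _ _ _ _ _ _ _ p p') pj _ refld => // y.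
apply/pP; have /p'P[s [Ss Yys vE]] : p' y = p' y by [].
exists (diff X n s); split; first exact: subcomplex_diff.
  by rewrite incl_restrict -linearB; apply: subcomplex_diff.
rewrite incl_restrict vE linearB (absorbs_diff rhoP) //.
exact: subcomplex_diff.
Qed.

Lemma difference_trivial n s : S n s -> Y' n s -> Y n s.
Proof.
move=> Ss Ys; have /eqP : s - rho s = 0.
  apply: (no_pure pure_difference) => [m _ [t [St _ ->]]|]; last by exists s.
  by rewrite linearB (absorbs_value rhoP) // subrr.
rewrite subr_eq0 => /eqP->; exact: absorbs_mem rhoP _ _ Ss.
Qed.

End Difference.

Lemma covered_of_no_pure : covered kappa1 (fun _ : homogeneous X => True).
Proof.
have z0 : kappa0 + M := inr 0.
(* The only generator is 0: what matters is that Y is pure, bounded and absorbing. The rest shows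
   that Y is everything. *)
have [|Y [Ypure [e eY] _ Yabs]] := pure_hull z0 (fun n => phi n)
    (fun _ : unit => of_degree (0 : X 0)) tt ring_injects1 target_injects.
  exact/singleton_injects/(countable_injects z0).
have [Yall|] := pselect (forall n x, Y n x).
  by exists e => -[n x] _; apply: eY; apply: Yall.
move=> /existsNP[n /existsNP[x nYx]]; case: nYx.
have [|Q [Qpure [eQ eQP] Qx]] := small_pure_hull
    (fun _ : unit => @of_degree _ (quo_complex Y) n (proj (Y n) x)) tt.
  exact/singleton_injects/(countable_injects (inr 0%N)).
pose lift (t : homogeneous (quo_complex Y)) : homogeneous X :=
  of_degree (projT1 (cid (proj_surj (projT2 t)))).
have liftE m (y : quo_complex Y m) : exists2 s, lift (of_degree y) = of_degree s &
    proj (Y m) s = y.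
  by rewrite /lift; case: cid => s /= sE; exists s.
(* S contains a representative of every class in Q, so S + Y contains the preimage of Q. *)
have [|S [Spure Scov SeQ]] /= := small_pure_hull (fun k => lift (eQ k)) (fun=> True).
  exact: injects_refl.
(* S has size at most [kappa0], which embeds in the index type of Y, so the single family [a]
   enumerates it. *)
have [a aS] := covered_injects (of_degree x) kappa0_injects (svalP (cid Scov)).
have [rho rhoP] := Yabs a.
have rhoS : absorbs (fun n => phi n) (fun n => S n) (fun n => Y n) rho.
  have aS' m s : S m s -> exists l, a l = of_degree s by move=> Ss; apply: aS.
  case: rhoP => rmem rid rlin rd rval; split.
  - by move=> m u /aS'; apply: rmem.
  - by move=> m u /aS'; apply: rid.
  - by move=> m; apply: partially_linear_sub (rlin m) => u /aS'.
  - by move=> m u /aS' au /aS'; apply: rd.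
  - by move=> m u /aS'; apply: rval.
have sum m y : quo_preimage Q m y -> exists2 s, S m s & Y m (y - s).
  move=> Qy; have [k kE] := eQP (of_degree (proj (Y m) y : quo_complex Y m)) Qy.
  have [s sE psE] := liftE m (proj (Y m) y).
  exists s; last exact/proj_eq/esym.
  have := SeQ k; rewrite kE sE.
  by [].
have le : subcomplex_le Y (quo_preimage Q).
  move=> m y /proj_eq0 Yy; rewrite quo_preimageE Yy; exact: submod0.
have Q'x : quo_preimage Q n x := Qx tt.
have [s Ss Yxs] := sum _ _ Q'x.
have Y's : quo_preimage Q n s.
  by rewrite -[s](subKr x); apply: submodB Q'x (le _ _ Yxs).
have Ys := difference_trivial (pure_preimage Ypure Qpure) le sum rhoS Ss Y's.
by rewrite -[x](subrK s); apply: submodD.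
Qed.

End NoPureKernel.

(** For P maximal, a pure subcomplex of X/P killed by the induced map pulls back to a pure
    subcomplex of the kernel of [phi] above P. By maximality it is zero, so [covered_of_no_pure]
    applies to X/P. *)
Lemma pure_quotient_bounded (X : complex R) (phi : forall n, {linear X n -> M}) :
  exists P : subcomplex X, [/\ pure P, forall n x, P n x -> phi n x = 0 &
    covered kappa1 (fun _ : homogeneous (quo_complex P) => True)].
Proof.
have [|P [Ppure Pphi Pmax]] := @maximal_pure _ X (fun n x => phi n x = 0).
  by move=> n; apply: linear0.
exists P; split=> //.
have psi_ex n : exists psi : {linear quomod_type (P n) -> M},
    forall x, psi (proj (P n) x) = phi n x.
  by apply: factor_surjective (@proj_surj _ _ (P n)) _ => x /proj_eq0; apply: Pphi.
pose psi n := projT1 (cid (psi_ex n)).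
have psiE n x : psi n (proj (P n) x) = phi n x := projT2 (cid (psi_ex n)) x.
apply: (@covered_of_no_pure (quo_complex P) psi) => P' P'pure P'psi n y P'y.
have [x xy] := proj_surj y; subst y; apply/proj_eq0.
apply: (Pmax (quo_preimage P')) => // [|m z|m z /proj_eq0 Pz].
- exact: pure_preimage.
- by rewrite quo_preimageE -psiE; apply: P'psi.
- by rewrite quo_preimageE Pz; apply: submod0.
Qed.

End PureHulls.

(** * Direct sums *)

Section DirectSums.
Variables (R : pzRingType) (J : eqType).

Section Sum.
Variable V : J -> lmodType R.

Definition component j (f : product V) : V j := f j.

Lemma component_linear j : linear (@component j).
Proof. by []. Qed.

Definition finite_support : submod (product V).
Proof.
exists (fun f => exists s : seq J, forall j, j \notin s -> component j f = 0) => [|a f g].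
  by exists [::].
move=> [s fs] [t gt]; exists (s ++ t) => j; rewrite mem_cat negb_or => /andP[js jt].
by rewrite component_linear fs // gt // scaler0 addr0.
Defined.

Definition dsum : lmodType R := submod_type finite_support.

Lemma dsum_proj_ex j : exists p : {linear dsum -> V j},
  forall f, p f = component j (incl finite_support f).
Proof. by exists (mk_linear (@component_linear j) \o incl finite_support). Qed.

Definition dsum_proj j := projT1 (cid (dsum_proj_ex j)).

Lemma dsum_projE j f : dsum_proj j f = component j (incl finite_support f).
Proof. exact: (projT2 (cid (dsum_proj_ex j))). Qed.

Lemma dsum_eq (f g : dsum) : (forall j, dsum_proj j f = dsum_proj j g) -> f = g.
Proof.
move=> fg; apply: incl_inj; apply: functional_extensionality_dep => j.
by have := fg j; rewrite !dsum_projE.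
Qed.

Lemma dsum_supp (f : dsum) : exists2 s : seq J, uniq s &
  forall j, j \notin s -> dsum_proj j f = 0.
Proof.
have [s fs] := incl_mem f; exists (undup s) => [|j]; first exact: undup_uniq.
by rewrite mem_undup dsum_projE; apply: fs.
Qed.

Lemma dsum_of (s : seq J) (f : forall j, V j) :
  (forall j, j \notin s -> f j = 0) -> exists g : dsum, forall j, dsum_proj j g = f j.
Proof.
move=> fs; have /inclP[g gE] : finite_support (f : product V) by exists s.
by exists g => j; rewrite dsum_projE gE.
Qed.

Lemma dsum_lift (U : lmodType R) (h : forall j, {linear U -> V j}) :
  (forall u, exists s : seq J, forall j, j \notin s -> h j u = 0) ->
  exists g : {linear U -> dsum}, forall j u, dsum_proj j (g u) = h j u.
Proof.
move=> hs; have [u|v v0|a u v u' v' uv uv'|g gP] :=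
    @linear_of_relation _ U dsum (fun u v => forall j, dsum_proj j v = h j u).
- by have [s /dsum_of[g gE]] := hs u; exists g.
- by apply: dsum_eq => j; rewrite v0 !linear0.
- by move=> j; rewrite !linearP uv uv'.
by exists g => j u; have /gP : g u = g u by [].
Qed.

Definition transport j k (e : j = k) (v : V j) : V k := ecast i (V i) e v.

Lemma transport_linear j k (e : j = k) : linear (transport e).
Proof. by subst k. Qed.

Lemma dsum_inj_ex j : exists i : {linear V j -> dsum},
  (forall v, dsum_proj j (i v) = v) /\
  forall k v, j != k -> dsum_proj k (i v) = 0.
Proof.
pose h k : {linear V j -> V k} :=
  if j =P k is ReflectT e then mk_linear (transport_linear e) else \0.
have h0 k : j != k -> h k =1 \0 by rewrite /h; case: eqP.
have [v|i iE] := @dsum_lift _ h.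
  by exists [:: j] => k; rewrite inE eq_sym => /h0 ->.
exists i; split=> [v|k v jk]; rewrite iE; last by rewrite h0.
by rewrite /h; case: eqP => // e; rewrite (eq_irrelevance e erefl).
Qed.

Definition dsum_inj j := projT1 (cid (dsum_inj_ex j)).

Lemma dsum_injK j v : dsum_proj j (dsum_inj j v) = v.
Proof. exact: (projT2 (cid (dsum_inj_ex j))).1. Qed.

Lemma dsum_inj0 j k v : j != k -> dsum_proj k (dsum_inj j v) = 0.
Proof. exact: (projT2 (cid (dsum_inj_ex j))).2. Qed.

Lemma dsum_restrict_ex (s : seq J) : exists e : {linear dsum -> dsum},
  forall j f, dsum_proj j (e f) = if j \in s then dsum_proj j f else 0.
Proof.
pose h j : {linear dsum -> V j} := if j \in s then dsum_proj j else \0.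
have [f|e eE] := @dsum_lift _ h.
  by exists s => j js; rewrite /h (negbTE js).
by exists e => j f; rewrite eE /h; case: ifP.
Qed.

Definition dsum_restrict s := projT1 (cid (dsum_restrict_ex s)).

Lemma dsum_restrictE s j f :
  dsum_proj j (dsum_restrict s f) = if j \in s then dsum_proj j f else 0.
Proof. exact: (projT2 (cid (dsum_restrict_ex s))). Qed.

Lemma dsum_restrict_cons j s f : j \notin s ->
  dsum_restrict (j :: s) f = dsum_inj j (dsum_proj j f) + dsum_restrict s f.
Proof.
move=> js; apply: dsum_eq => k; rewrite linearD /= !dsum_restrictE inE.
case: (eqVneq k j) => [->|kj] /=; first by rewrite (negbTE js) dsum_injK addr0.
by rewrite dsum_inj0 ?add0r // eq_sym.
Qed.

(** All lists containing the support give the same sum, so quantifying existentially over the list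
    defines a linear relation. *)
Lemma dsum_colift (W : lmodType R) (phi : forall j, {linear V j -> W}) :
  exists g : {linear dsum -> W}, forall j v, g (dsum_inj j v) = phi j v.
Proof.
pose sum s (f : dsum) := \sum_(j <- s) phi j (dsum_proj j f).
have sum_sub s t f : uniq s -> uniq t -> {subset s <= t} ->
    (forall j, j \notin s -> dsum_proj j f = 0) -> sum t f = sum s f.
  move=> s_uniq t_uniq st fs; rewrite /sum (bigID (mem s)) /= [X in _ + X]big1 ?addr0.
    rewrite -big_filter; apply: perm_big; apply: uniq_perm => //.
      exact: filter_uniq.
    by move=> j; rewrite mem_filter andb_idr // => /st.
  by move=> j js; rewrite fs // linear0.
have [f|v [s [s_uniq _ ->]]|a f v f' v'|g gP] :=
    @linear_of_relation _ dsum W (fun f v => exists s, [/\ uniq s,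
      forall j, j \notin s -> dsum_proj j f = 0 & v = sum s f]).
- by have [s s_uniq fs] := dsum_supp f; exists (sum s f), s.
- by rewrite /sum big1 // => j _; rewrite !linear0.
- move=> [s [s_uniq fs ->]] [s' [s'_uniq fs' ->]]; exists (undup (s ++ s')).
  have sub_s : {subset s <= undup (s ++ s')}.
    by move=> j js; rewrite mem_undup mem_cat js.
  have sub_s' : {subset s' <= undup (s ++ s')}.
    by move=> j js; rewrite mem_undup mem_cat js orbT.
  split; first exact: undup_uniq.
    move=> j; rewrite mem_undup mem_cat negb_or => /andP[js js'].
    by rewrite linearP fs // fs' // scaler0 addr0.
  rewrite -(sum_sub s (undup (s ++ s')) f) ?undup_uniq //.
  rewrite -(sum_sub s' (undup (s ++ s')) f') ?undup_uniq //.
  rewrite /sum scaler_sumr -big_split /=; apply: eq_bigr => j _.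
  by rewrite !linearP.
exists g => j v; apply/gP; exists [:: j]; split=> // [k|].
  by rewrite inE => kj; rewrite dsum_inj0 // eq_sym.
by rewrite /sum big_seq1 dsum_injK.
Qed.

Lemma dsum_hom_ext (W : lmodType R) (g g' : {linear dsum -> W}) :
  (forall j v, g (dsum_inj j v) = g' (dsum_inj j v)) -> g =1 g'.
Proof.
move=> gg' f; have [s s_uniq fs] := dsum_supp f.
have -> : f = dsum_restrict s f.
  apply: dsum_eq => j; rewrite dsum_restrictE; case: ifPn => // js; exact: fs.
elim: s s_uniq {fs} => [_|j s IHs /= /andP[js /IHs IH]]; last first.
  by rewrite dsum_restrict_cons // !linearD gg' IH.
have -> : dsum_restrict [::] f = 0 by apply: dsum_eq => j; rewrite dsum_restrictE linear0.
by rewrite !linear0.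
Qed.

Lemma tensor_dsum_cons (B : lmodType R^c) j s (w : tensor B dsum) : j \notin s ->
  tensor_map (idfun : {linear B -> B}) (dsum_restrict (j :: s)) w =
  tensor_map idfun (dsum_inj j) (tensor_map idfun (dsum_proj j) w) +
  tensor_map idfun (dsum_restrict s) w.
Proof.
move=> js; elim/tensor_ind: w => [|x y xE yE|b f].
- by rewrite !raddf0 addr0.
- by rewrite !raddfB /= xE yE opprD addrACA.
- by rewrite !tensor_map_tens -tensDr dsum_restrict_cons.
Qed.

(** This stands in for the commutation of tensor products with direct sums: tensors are handled on
    finite truncations, by induction on the list of indices. *)
Lemma tensor_dsum_support (B : lmodType R^c) (w : tensor B dsum) :
  exists2 s : seq J, uniq s &
    tensor_map (idfun : {linear B -> B}) (dsum_restrict s) w = w.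
Proof.
have grow s t (x : tensor B dsum) : {subset s <= t} ->
    tensor_map idfun (dsum_restrict s) x = x -> tensor_map idfun (dsum_restrict t) x = x.
  move=> st xE; rewrite -[in LHS]xE -[RHS]xE; apply: tensor_map_comp => // f.
  apply: dsum_eq => j; rewrite !dsum_restrictE; case: (boolP (j \in s)) => [/st->//|_].
  by case: ifP.
suff [s sE] : exists s, tensor_map (idfun : {linear B -> B}) (dsum_restrict s) w = w.
  by exists (undup s); [apply: undup_uniq|apply: grow sE => j; rewrite mem_undup].
elim/tensor_ind: w => [|x y [s xs] [t yt]|b f].
- by exists [::]; rewrite raddf0.
- exists (s ++ t); rewrite raddfB /=; congr (_ - _).
    by apply: grow xs => j js; rewrite mem_cat js.
  by apply: grow yt => j js; rewrite mem_cat js orbT.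
- have [s _ fs] := dsum_supp f; exists s; rewrite tensor_map_tens; congr tens.
  by apply: dsum_eq => j; rewrite dsum_restrictE; case: ifPn => // /fs.
Qed.

End Sum.

Arguments dsum_proj {V} j.
Arguments dsum_inj {V} j.
Arguments dsum_restrict {V} s.


Section Map.
Variables (V V' : J -> lmodType R) (d : forall j, {linear V j -> V' j}).

Lemma dsum_map_ex : exists g : {linear dsum V -> dsum V'},
  forall j f, dsum_proj j (g f) = d j (dsum_proj j f).
Proof.
have [f|g gE] := @dsum_lift V' (dsum V) (fun j => d j \o dsum_proj j); last by exists g.
by have [s _ fs] := dsum_supp f; exists s => j js; rewrite /= fs // linear0.
Qed.

Definition dsum_map := projT1 (cid dsum_map_ex).

Lemma dsum_projM j f : dsum_proj j (dsum_map f) = d j (dsum_proj j f).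
Proof. exact: (projT2 (cid dsum_map_ex)). Qed.

Lemma dsum_mapM j v : dsum_map (dsum_inj j v) = dsum_inj j (d j v).
Proof.
apply: dsum_eq => k; rewrite dsum_projM; case: (eqVneq j k) => [<-|jk].
  by rewrite !dsum_injK.
by rewrite !dsum_inj0 // linear0.
Qed.

End Map.

Section Exactness.
Variables (V1 V0 V2 : J -> lmodType R).
Variables (d1 : forall j, {linear V1 j -> V0 j}) (d2 : forall j, {linear V0 j -> V2 j}).

Lemma exact_at_dsum_tensor (B1 B0 B2 : lmodType R^c) (h1 : {linear B1 -> B0})
    (h2 : {linear B0 -> B2}) :
  (forall j, exact_at (tensor_map h1 (d1 j)) (tensor_map h2 (d2 j))) ->
  exact_at (tensor_map h1 (dsum_map d1)) (tensor_map h2 (dsum_map d2)).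
Proof.
move=> ex y; split=> [y0|[x <-]].
  (* [y] equals its truncation to [s]; preimages of truncations of [y] are now built one component
     at a time. *)
  have [s s_uniq <-] := tensor_dsum_support y.
  elim: s s_uniq => [_|j s IHs /= /andP[js /IHs[x xE]]].
    exists 0; rewrite raddf0 tensor_map0 // => f.
    by apply: dsum_eq => j; rewrite dsum_restrictE linear0.
  have [|z zE] := (ex j (tensor_map idfun (dsum_proj j) y)).1.
    rewrite (@tensor_map_square _ _ _ _ _ _ _ _ _ idfun h2 h2 idfun _ _
      (dsum_map d2) (dsum_proj j)) ?y0 ?raddf0 // => f.
    by rewrite dsum_projM.
  exists (tensor_map idfun (dsum_inj j) z + x); rewrite raddfD /= xE.
  rewrite (@tensor_map_square _ _ _ _ _ _ _ _ _ idfun h1 h1 idfun _ _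
    (d1 j) (dsum_inj j)) //; last by move=> f; rewrite dsum_mapM.
  by rewrite zE tensor_dsum_cons.
have zero j z : tensor_map h2 (d2 j) (tensor_map h1 (d1 j) z) = 0.
  by apply/ex; exists z.
elim/tensor_ind: x => [|x1 x2 x1E x2E|b f]; first by rewrite !raddf0.
  by rewrite !raddfB /= x1E x2E subrr.
rewrite !tensor_map_tens; have [s s_uniq fs] := dsum_supp f.
have -> : f = dsum_restrict s f.
  by apply: dsum_eq => j; rewrite dsum_restrictE; case: ifPn => // /fs.
elim: s s_uniq {fs} => [_|j s IHs /= /andP[js /IHs IH]].
  have -> : dsum_restrict [::] f = 0 by apply: dsum_eq => j; rewrite dsum_restrictE linear0.
  by rewrite !linear0 tens0r.
rewrite dsum_restrict_cons // !linearD tensDr IH addr0 !dsum_mapM.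
rewrite -tensor_map_tens; have := zero j (tens b (dsum_proj j f)).
rewrite !tensor_map_tens => /(congr1 (tensor_map idfun (dsum_inj j))).
by rewrite tensor_map_tens raddf0.
Qed.

Lemma exact_at_dsum : (forall j, exact_at (d1 j) (d2 j)) ->
  exact_at (dsum_map d1) (dsum_map d2).
Proof.
move=> ex y; split=> [y0|[x <-]]; last first.
  by apply: dsum_eq => j; rewrite !dsum_projM linear0; apply/ex; exists (dsum_proj j x).
have [s s_uniq ys] := dsum_supp y.
(* Outside the support of [y] the preimage must be chosen to be 0, so that the resulting family has
   finite support. *)
have x_ex j : exists x : V1 j, d1 j x = dsum_proj j y /\ (j \notin s -> x = 0).
  have [js|js] := boolP (j \in s); last by exists 0; rewrite linear0 ys.
  have [|x xE] := (ex j (dsum_proj j y)).1; last by exists x.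
  by rewrite -dsum_projM y0 linear0.
have [j js|x xE] := @dsum_of V1 s (fun j => projT1 (cid (x_ex j))).
  by case: cid => x /= [_]; apply.
exists x; apply: dsum_eq => j; rewrite dsum_projM xE.
by case: cid => z /= [].
Qed.

End Exactness.
End DirectSums.

Arguments dsum_proj {R J V} j.
Arguments dsum_inj {R J V} j.

(** * Precovers *)

Section DirectSumComplex.
Variables (R : pzRingType) (J : eqType) (X : J -> complex R).

Definition dsum_diff n := dsum_map (fun j => diff (X j) n).

Lemma dsum_diffK n x : dsum_diff n (dsum_diff (n + 1) x) = 0.
Proof. by apply: dsum_eq => j; rewrite !dsum_projM diffK linear0. Qed.

Definition dsum_complex : complex R :=
  @Complex R (fun n => dsum (fun j => X j n)) dsum_diff dsum_diffK.

Lemma good_dsum (Bc : lmodType R^c -> Prop) :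
  (forall j, good Bc (X j)) -> good Bc dsum_complex.
Proof.
move=> Xgood; split=> [n B1 B0 B2 h1 h2 ex|n|B BcB n].
- have dsum1 : dsum_map (fun j => (idfun : {linear X j n -> X j n})) =1 idfun.
    by move=> f; apply: dsum_eq => j; rewrite dsum_projM.
  apply: exact_at_ext (tensor_map_eq (frefl _) dsum1) (tensor_map_eq (frefl _) dsum1) _.
  by apply: exact_at_dsum_tensor => j; have [flatX _ _] := Xgood j; apply: flatX.
- by apply: exact_at_dsum => j; have [_ exX _] := Xgood j; apply: exX.
- by apply: exact_at_dsum_tensor => j; have [_ _ acX] := Xgood j; apply: acX.
Qed.

End DirectSumComplex.

Section Codes.
Variables (R : pzRingType) (M : Type) (K : Type).

(** Complexes over [M] form a large type, whereas a direct sum needs an index type in the universe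
    of the carriers. A code describes a complex by names in [K], without mentioning the complex. *)
Record code : Type := Code {
  code_rel : operation R -> K -> K -> K -> Prop;
  code_value : K -> int -> M -> Prop }.

Definition code_of (X : complex R) (phi : forall n, X n -> M)
    (j : homogeneous X -> K) : code :=
  Code (fun o a b c => exists x y z, [/\ op_rel o x y z, j x = a, j y = b & j z = c])
       (fun a n m => exists u : X n, j (of_degree u) = a /\ phi n u = m).

(** The map sends an element to the one with the same name. It exists in the same degree and over
    the same value because [code_value] records both, and it is a chain map because the code
    contains the graphs of the operations. *)
Lemma code_eq_map (X X' : complex R) (phi : forall n, X n -> M)
    (phi' : forall n, X' n -> M) (j : homogeneous X -> K) (j' : homogeneous X' -> K) :
  injective j' -> code_of phi j = code_of phi' j' ->
  exists theta : forall n, {linear X n -> X' n},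
  [/\ forall n x, theta n (diff X n x) = diff X' n (theta (n + 1) x) &
      forall n x, phi' n (theta n x) = phi n x].
Proof.
move=> j'_inj cc'.
pose G n (u : X n) (v : X' n) := j' (of_degree v) = j (of_degree u).
have G_ex n (u : X n) : exists v, G n u v /\ phi' n v = phi n u.
  have : code_value (code_of phi j) (j (of_degree u)) n (phi n u) by exists u.
  by rewrite cc' => -[v [jv phiv]]; exists v.
have G_inj n (u : X n) v v' : G n u v -> G n u v' -> v = v'.
  by move=> uv uv'; apply/of_degree_inj/j'_inj; rewrite uv uv'.
have G_rel o n m l (x : X n) (y : X m) (z : X l) x' y' z' :
    op_rel o (of_degree x) (of_degree y) (of_degree z) ->
    G n x x' -> G m y y' -> G l z z' ->
    op_rel o (of_degree x') (of_degree y') (of_degree z').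
  move=> oxyz xx' yy' zz'.
  have : code_rel (code_of phi j) o (j (of_degree x)) (j (of_degree y)) (j (of_degree z)).
    by exists (of_degree x), (of_degree y), (of_degree z).
  rewrite cc' -xx' -yy' -zz' => -[a [b [c [oabc /j'_inj <- /j'_inj <- /j'_inj <-]]]].
  by [].
have G_add n (x y : X n) x' y' : G n x x' -> G n y y' -> G n (x + y) (x' + y').
  move=> xx' yy'; have [z' [zz' _]] := G_ex n (x + y).
  by have /op_rel_add <- := G_rel _ _ _ _ _ _ _ _ _ _ ((op_rel_add _ _ _).2 erefl) xx' yy' zz'.
have G_scale n r (x : X n) x' : G n x x' -> G n (r *: x) (r *: x').
  move=> xx'; have [z' [zz' _]] := G_ex n (r *: x).
  by have /op_rel_scale <- :=
    G_rel _ _ _ _ _ _ _ _ _ _ ((op_rel_scale _ _ _ (of_degree x)).2 erefl) xx' zz' xx'.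
have theta_ex n : exists theta : {linear X n -> X' n}, forall u v, G n u v <-> theta u = v.
  apply: linear_of_relation => [u|v v0|a u v u' v' uv uv'].
  - by have [v [uv _]] := G_ex n u; exists v.
  - by apply: (addrI v); rewrite addr0; apply: G_inj (_ : G n 0 _) => //;
      rewrite -[0]addr0; apply: G_add.
  - exact/G_add/uv'/G_scale.
pose theta n := projT1 (cid (theta_ex n)).
have thetaP n u v : G n u v <-> theta n u = v := projT2 (cid (theta_ex n)) u v.
exists theta; split=> n x.
  have xx' : G (n + 1) x (theta (n + 1) x) by apply/thetaP.
  have dx : G n (diff X n x) (theta n (diff X n x)) by apply/thetaP.
  by have /op_rel_diff <- :=
    G_rel _ _ _ _ _ _ _ _ _ _ ((op_rel_diff _ _ (of_degree x)).2 erefl) xx' dx xx'.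
have [v [xv <-]] := G_ex n x.
by move/thetaP: xv => ->.
Qed.

End Codes.

Section Precovers.
Variables (R : pzRingType) (Bc : lmodType R^c -> Prop) (M : lmodType R).

(* A good complex over [M], the latter being placed in every degree; only degree 1
   matters. *)
Record over : Type := Over {
  over_cx :> complex R;
  over_map : forall n, {linear over_cx n -> M};
  over_good : good Bc over_cx;
  over_mapK : forall n x, over_map n (diff over_cx n x) = 0 }.

Definition weakly_terminal (T : over) : Prop :=
  forall X : over, exists c : forall n, {linear X n -> T n},
    (forall n x, c n (diff X n x) = diff T n (c (n + 1) x)) /\
    forall n x, over_map T n (c n x) = over_map X n x.

Lemma over_code (X : over) : exists (P : over) (j : homogeneous P -> kappa1 M),
  injective j /\ exists c : forall n, {linear X n -> P n},
    (forall n x, c n (diff X n x) = diff P n (c (n + 1) x)) /\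
    forall n x, over_map P n (c n x) = over_map X n x.
Proof.
have [P [Ppure Pphi Pcov]] := pure_quotient_bounded (over_map X).
have psi_ex n : exists psi : {linear quo_complex P n -> M},
    forall x, psi (proj (P n) x) = over_map X n x.
  by apply: factor_surjective (@proj_surj _ _ (P n)) _ => x /proj_eq0; apply: Pphi.
pose psi n := projT1 (cid (psi_ex n)).
have psiE n x : psi n (proj (P n) x) = over_map X n x := projT2 (cid (psi_ex n)) x.
have psiK n x : psi n (diff (quo_complex P) n x) = 0.
  have [y yx] := proj_surj x; subst x.
  by rewrite [diff (quo_complex P) n _]induced_proj psiE over_mapK.
have [j j_inj] := covered_inverse Pcov.
exists (Over (good_quo (over_good X) Ppure) psiK), j; split=> //.
exists (fun n => proj (P n)); split=> n x; last exact: psiE.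
exact/esym/induced_proj.
Qed.

Lemma weakly_terminal_ex : exists T : over, weakly_terminal T.
Proof.
pose realizes (c : code R M (kappa1 M)) (X : over) :=
  exists2 j : homogeneous X -> kappa1 M, injective j & code_of (over_map X) j = c.
pose J0 := {c | exists X, realizes c X}.
pose J : eqType := HB.pack J0 (gen_eqMixin J0).
pose X (c : J) : over := projT1 (cid (svalP c)).
have XP c : realizes (sval c) (X c) := projT2 (cid (svalP c)).
pose T := dsum_complex X.
have phi_ex n : exists phi : {linear T n -> M},
    forall c (v : X c n), phi (dsum_inj c v) = over_map (X c) n v.
  exact: dsum_colift.
pose phi n := projT1 (cid (phi_ex n)).
have phiE n c v : phi n (dsum_inj c v) = over_map (X c) n v := projT2 (cid (phi_ex n)) c v.
have phiK n x : phi n (diff T n x) = 0.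
  apply: (dsum_hom_ext (g := phi n \o diff T n) (g' := \0)) => c v /=.
  by rewrite [diff T n _]dsum_mapM phiE over_mapK.
have Tgood : good Bc T by apply: good_dsum => c; apply: over_good.
exists (Over Tgood phiK) => Y.
(* The summand indexed by the code of [P] may be another complex with the same code; [code_eq_map]
   leads from [P] to it. *)
have [P [j [j_inj [q [qd qphi]]]]] := over_code Y.
have Pj : exists X, realizes (code_of (over_map P) j) X by exists P, j.
pose c : J := exist _ _ Pj.
have [j' j'_inj cE] := XP c.
have [theta [theta_d theta_phi]] := code_eq_map j'_inj (esym cE).
exists (fun n => dsum_inj c \o (theta n \o q n)); split=> n x /=.
  by rewrite qd theta_d [RHS]dsum_mapM.
by rewrite phiE theta_phi qphi.
Qed.

Definition in_degree_one (X : complex R) (f : {linear X (Posz 1) -> M}) n :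
    {linear X n -> M} :=
  match n with Posz 1 => f | _ => \0 end.

Lemma precover : exists (X : lmodType R) (phi : {linear X -> M}),
  gorenstein_flat Bc X /\ forall (X' : lmodType R) (f : {linear X' -> M}),
    gorenstein_flat Bc X' -> exists g : {linear X' -> X}, forall x, phi (g x) = f x.
Proof.
have [T Tterm] := weakly_terminal_ex; have [Tflat Tex Tac] := over_good T.
pose Z : submod (T 0) := submod_kernel (diff T (- 1)).
have Z_bound (z : submod_type Z) : exists x, diff T 0 x = incl Z z.
  by apply/(Tex (- 1)); apply: (incl_mem z).
(* A cycle dx goes to the value of x in [M]. This is well defined because the x with dx = 0 are
   boundaries, which [over_map] kills. The degree [Posz 1] is convertible to [0 + 1]. *)
have [z|v [x [x0 <-]]|a z v z' v' [x [xz <-]] [x' [xz' <-]]|phi phiP] :=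
    @linear_of_relation R (submod_type Z) M
      (fun z v => exists x, diff T 0 x = incl Z z /\ over_map T (Posz 1) x = v).
- by have [x xz] := Z_bound z; exists (over_map T (Posz 1) x), x.
- have [|y <-] := (Tex 0 x).1; first by rewrite x0 linear0.
  exact: over_mapK.
- by exists (a *: x + x'); rewrite !linearP xz xz'.
exists (submod_type Z), phi; split.
  exists T; split=> //; exists (incl Z); split; first exact: incl_inj.
  by move=> y; split=> [/(inclP (U := Z)) //|[x <-]]; apply: (incl_mem x).
move=> X' f [F [Fflat Fex Fac [i [i_inj iE]]]].
(* [g1] is the differential F_1 -> F_0 corestricted to Z_0(F), so [f \o g1] kills boundaries and
   puts F over [M]. *)
have [|g1 g1E] := factor_injective (h := diff F 0) i_inj.
  by move=> u; apply/iE; apply: diffK.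
have phiK n x : in_degree_one (f \o g1) n (diff F n x) = 0.
  case: n x => [[|[|n]]|n] x //=.
  suff -> : g1 (diff F 1 x) = 0 by rewrite linear0.
  by apply: i_inj; rewrite g1E linear0; apply: (diffK (n := 0)).
have [c [cd cphi]] := Tterm (Over (And3 Fflat Fex Fac) phiK).
have [u|g gE] := factor_injective (h := c 0 \o i) (@incl_inj _ _ Z).
  apply: inclP; rewrite /Z /submod_kernel submod_preimageE /=.
  have <- := cd (- 1) (i u); rewrite [diff _ _ _](_ : _ = 0) ?linear0 //.
  by apply/iE; exists u.
exists g => x; apply/phiP; have [u ux] := (Fex (- 1) (i x)).1 ((iE _).2 (ex_intro _ x erefl)).
exists (c (Posz 1) u); rewrite -(cd 0) gE /=; split; first by congr (c 0 _).
rewrite cphi /=; congr (f _); apply: i_inj; rewrite g1E; exact: ux.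
Qed.

End Precovers.

Lemma gorenstein_flat_precovering (R : pzRingType) (Bc : lmodType R^c -> Prop) :
  precovering (gorenstein_flat Bc).
Proof. exact: precover. Qed.

(** * The Kaplansky property *)

Section Presentability.
Variables (R : pzRingType) (k K : smallType).
Hypotheses (nat_k : injects nat k) (k_square : injects (k * k) k).
Hypothesis R_k : covered k (fun _ : R => True).
Hypothesis covered_lt : forall (U : Type) (A : set U), covered k A -> card_lt A [set: K]%classic.
Hypothesis lt_covered : forall (U : Type) (u0 : U) (A : set U),
  card_lt A [set: K]%classic -> covered k A.

Lemma covered_prod (A B : Type) (a0 : A) (b0 : B) :
  covered k (fun _ : A => True) -> covered k (fun _ : B => True) ->
  covered k (fun _ : A * B => True).
Proof.
move=> [e eA] [f fB].
apply: (covered_injects (f := fun p => (e p.1, f p.2)) (a0, b0) k_square) => -[a b] _.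
by have [[x <-] [y <-]] := (eA a I, fB b I); exists (x, y).
Qed.

Section Directed.
Variable I : directed_poset K.

Lemma directed_sup (A : Type) (F : A -> I) :
  covered k (fun _ : A => True) -> exists u, forall a, le (F a) u.
Proof.
move=> [e eA]; have [|u uP] := @le_directed K I (fun i => exists a, F a = i).
  apply: covered_lt; exists (F \o e) => _ [a <-].
  by have [x <-] := eA a Logic.I; exists x.
by exists u => a; apply: uP; exists a.
Qed.

Lemma directed_pair (i j : I) : exists u, le i u /\ le j u.
Proof.
have [|u uP] := directed_sup (fun b : bool => if b then i else j).
  apply: (@covered_injects bool _ _ _ true id) => [|b _]; last by exists b.
  by apply: injects_trans nat_k; exists nat_of_bool; case; case.
by exists u; split; [apply: (uP true)|apply: (uP false)].
Qed.

(** The element is an upper bound of the empty set. *)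
Lemma directed_inhabited : exists i : I, True.
Proof.
have [|u _] := @le_directed K I (fun _ => False); last by exists u.
move=> /card_le_injection[f _ nf].
have : card_lt (fun _ : unit => True) [set: K]%classic.
  by apply: covered_lt; exists (fun=> tt) => -[] _; have [g _] := nat_k; exists (g 0%N).
apply; apply/card_le_injection; exists (fun=> tt) => // x; case: (nf x).
Qed.

Variables (D : diagram R I) (C : lmodType R) (c : forall i, {linear D i -> C}).
Hypothesis colim : is_colimit c.

(** By directedness the images of the stages form a submodule U. The projection to C/U and the zero
    map agree on all stages, so they coincide by uniqueness, and U is everything. *)
Lemma colimit_surj z : exists i x, c i x = z.
Proof.
have [cc cu] := colim.
have U_lin a x y : (exists i u, c i u = x) -> (exists i u, c i u = y) ->
    exists i u, c i u = a *: x + y.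
  move=> [i [u <-]] [j [v <-]]; have [l [il jl]] := directed_pair i j.
  by exists l, (a *: tr D il u + tr D jl v); rewrite linearP /= !cc.
have U0 : exists i u, c i u = 0.
  by have [i _] := directed_inhabited; exists i, 0; rewrite linear0.
pose U := Submod U0 U_lin.
have [//|g [_ g_uniq]] := cu (quomod_type U) (fun i => \0).
have proj_g := g_uniq (proj U); have zero_g := g_uniq (\0).
suff : U z by [].
apply/proj_eq0; rewrite proj_g => [|i x]; last by apply/proj_eq0; exists i, x.
by rewrite -zero_g.
Qed.

Lemma tr_irrelevant i j (h h' : le i j) x : tr D h x = tr D h' x.
Proof. by rewrite (Prop_irrelevance h h'). Qed.

(* The colimit maps to the product of the [D j] modulo eventually zero families,
   where a class is zero only if it dies at some stage. *)
Lemma colimit_ker i x : c i x = 0 -> exists j (h : le i j), tr D h x = 0.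
Proof.
have [_ cu] := colim.
pose comp (f : product D) j : D j := f j.
have N_lin a f g : (exists l, forall j, le l j -> comp f j = 0) ->
    (exists l, forall j, le l j -> comp g j = 0) ->
    exists l, forall j, le l j -> comp (a *: f + g) j = 0.
  move=> [l fl] [m gm]; have [u [lu mu]] := directed_pair l m.
  exists u => j uj; rewrite [LHS]productDE [X in X + _]productZE.
  by rewrite [f j]fl ?[g j]gm ?scaler0 ?addr0 //; apply: le_trans uj.
have N0 : exists l, forall j, le l j -> comp 0 j = 0.
  by have [l _] := directed_inhabited; exists l.
pose N := Submod N0 N_lin.
pose t_fun l (y : D l) : product D :=
  fun j => if pselect (le l j) is left h then tr D h y else 0.
have t_lin l : linear (@t_fun l).
  move=> a y z; apply: functional_extensionality_dep => j.
  rewrite [RHS]productDE [X in _ = X + _]productZE /t_fun.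
  by case: pselect => h; rewrite ?linearP ?scaler0 ?addr0.
pose e l : {linear D l -> quomod_type N} := proj N \o mk_linear (t_lin l).
have e_cocone : cocone e.
  move=> l m lm y; apply/proj_eq; exists m => j mj.
  rewrite [LHS]productDE; apply/eqP; rewrite subr_eq0; apply/eqP; rewrite /= /t_fun.
  case: pselect => [h|//]; case: pselect => [h'|[]]; first exact: tr_comp.
  exact: le_trans mj.
have [g [gE _]] := cu _ _ e_cocone.
move=> cx0; have /proj_eq0[l xl] : e i x = 0 by rewrite -gE cx0 linear0.
have [u [iu lu]] := directed_pair i l; exists u, iu.
have := xl u lu; rewrite /comp /= /t_fun; case: pselect => // h <-.
exact: tr_irrelevant.
Qed.

End Directed.

(** A map to the colimit lifts pointwise to one stage. Each failure of linearity dies later, and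
    there are at most [k] of them, one per triple in R * S * S, so the lift becomes linear at a
    common later stage. Two lifts are made equal in the same way. *)
Lemma presentable_covered (S : lmodType R) :
  covered k (fun _ : S => True) -> presentable K S.
Proof.
move=> Sk I D C c colim; have [cc _] := colim; split=> [f|i j h h' hh'].
  have /choice[y0 y0E] s : exists t : {i & D i}, c _ (projT2 t) = f s.
    by have [i [x xE]] := colimit_surj colim (f s); exists (existT _ i x).
  have [u uP] := directed_sup (fun s => projT1 (y0 s)) Sk.
  pose h0 s : D u := tr D (uP s) (projT2 (y0 s)).
  have h0E s : c u (h0 s) = f s by rewrite cc.
  have dies (p : R * S * S) : exists j (uj : le u j),
      tr D uj (h0 (p.1.1 *: p.1.2 + p.2) - (p.1.1 *: h0 p.1.2 + h0 p.2)) = 0.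
    by apply: (colimit_ker colim); rewrite linearB linearP /= !h0E linearP subrr.
  have /choice[j0 j0P] := dies.
  have [|v vP] := directed_sup j0.
    by apply: covered_prod => //; [exact: (0, 0)|exact: 0|apply: covered_prod => //; exact: 0].
  have uv : le u v.
    by have [uj _] := j0P (0, 0, 0); apply: le_trans uj (vP _).
  have h_lin : linear (fun s => tr D uv (h0 s)).
    move=> a s s'; apply/eqP; rewrite -linearP -subr_eq0 -linearB; apply/eqP.
    have [uj ujE] := j0P (a, s, s').
    by rewrite -(tr_comp uj (vP (a, s, s'))) ujE linear0.
  by exists v, (mk_linear h_lin) => s /=; rewrite cc h0E.
have [u [iu ju]] := directed_pair i j.
have dies s : exists l (ul : le u l), tr D ul (tr D iu (h s) - tr D ju (h' s)) = 0.
  by apply: (colimit_ker colim); rewrite linearB /= !cc hh' subrr.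
have /choice[l0 l0P] := dies.
have [v vP] := directed_sup l0 Sk.
have uv : le u v by have [ul _] := l0P 0; apply: le_trans ul (vP _).
exists v, (le_trans iu uv), (le_trans ju uv) => s.
rewrite -(tr_comp iu uv) -(tr_comp ju uv); apply/eqP; rewrite -subr_eq0 -linearB.
have [ul ulE] := l0P s.
by rewrite -(tr_comp ul (vP s)) ulE linear0.
Qed.

Section Generated.
Variable M : lmodType R.

Definition span (S : M -> Prop) : submod M.
Proof.
exists (fun x => forall U : submod M, (forall y, S y -> U y) -> U x) => [U _|a x y Sx Sy U SU].
  exact: submod0.
by apply: submodP; [apply: Sx|apply: Sy].
Defined.

Lemma span_mem (S : M -> Prop) x : S x -> span S x.
Proof. by move=> Sx U; apply. Qed.

Lemma span_le (S : M -> Prop) (U : submod M) :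
  (forall y, S y -> U y) -> forall x, span S x -> U x.
Proof. by move=> SU x; apply. Qed.

(** Elements are submodules for which a generating family merely exists; recording the family would
    break antisymmetry of inclusion. *)
Definition small_span : smallType :=
  {U : submod M | exists g : k -> M, U = span (fun x => exists a, g a = x)}.

Definition small_span_of (g : k -> M) : small_span :=
  exist _ (span (fun x => exists a, g a = x)) (ex_intro _ g erefl).

Definition small_span_le (U V : small_span) : Prop := forall x, sval U x -> sval V x.

Lemma small_span_anti U V : small_span_le U V -> small_span_le V U -> U = V.
Proof.
case: U V => [U Uk] [V Vk] UV VU.
have eUV : U = V by apply: submod_eqP => x; split; [apply: UV|apply: VU].
by subst V; rewrite (Prop_irrelevance Uk Vk).
Qed.

(** At most [k] submodules with [k] generators each lie in one with [k * k] generators, hence with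
    [k]. *)
Lemma small_span_directed (J : set small_span) : card_lt J [set: K]%classic ->
  exists u, forall j, J j -> small_span_le j u.
Proof.
move=> /(lt_covered (small_span_of (fun=> 0)))[e eJ].
pose g a := projT1 (cid (svalP (e a))).
have gE a : sval (e a) = span (fun x => exists b, g a b = x) := projT2 (cid (svalP (e a))).
have [h hP] : covered k (fun x => exists p : k * k, g p.1 p.2 = x).
  by apply: (covered_injects (f := fun p => g p.1 p.2) 0 k_square).
exists (small_span_of h) => _ /eJ[a <-] x; rewrite gE; apply: span_le => y [b <-].
by apply: span_mem; apply: hP; exists (a, b).
Qed.

Definition span_poset : directed_poset K :=
  @DirectedPoset K small_span small_span_le (fun U x Ux => Ux)
    (fun U V W UV VW x Ux => VW x (UV x Ux)) small_span_anti small_span_directed.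

Definition span_obj (U : span_poset) : lmodType R := submod_type (sval (U : small_span)).
Definition span_tr (U V : span_poset) (h : le U V) : {linear span_obj U -> span_obj V} :=
  inclusion h.

Lemma span_tr_id U (h : le U U) x : span_tr h x = x.
Proof. exact: incl_inj. Qed.

Lemma span_tr_comp U V W (h : le U V) (h' : le V W) (h'' : le U W) x :
  span_tr h' (span_tr h x) = span_tr h'' x.
Proof. exact: incl_inj. Qed.

Definition span_diagram : diagram R span_poset :=
  @Diagram R K span_poset span_obj span_tr span_tr_id span_tr_comp.

Definition span_incl (U : span_poset) : {linear span_diagram U -> M} :=
  incl (sval (U : small_span)).

Lemma span_colimit : is_colimit span_incl.
Proof.
split=> [//|E e ee].
have in_span x : exists (U : span_poset) (y : span_diagram U), span_incl U y = x.
  have /inclP[y yE] : sval (small_span_of (fun=> x)) x.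
    by apply: span_mem; have [f _] := nat_k; exists (f 0%N).
  by exists (small_span_of (fun=> x)), y.
have [x|v [U [y [y0 <-]]]|a x v x' v' [U [y [yx <-]]] [U' [y' [yx' <-]]]|g gP] :=
    @linear_of_relation R M E (fun x v => exists (U : span_poset) (y : span_diagram U),
      span_incl U y = x /\ e U y = v).
- by have [U [y yx]] := in_span x; exists (e U y), U, y.
- have -> : y = 0 by apply: incl_inj; rewrite linear0; exact: y0.
  exact: linear0.
- have [V [UV U'V]] := directed_pair U U'.
  exists V, (a *: tr span_diagram UV y + tr span_diagram U'V y').
  by rewrite !linearP /= !ee -yx -yx'.
exists g; split=> [U y|g' g'E x]; first by apply/gP; exists U, y.
by have [U [y <-]] := in_span x; rewrite g'E; apply/esym/gP; exists U, y.
Qed.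

(** M is the directed union of its submodules with [k] generators. The identity of M factors through
    one of them, which is therefore all of M. *)
Lemma generated_span : generated K M ->
  exists g : k -> M, forall U : submod M, (forall a, U (g a)) -> forall x, U x.
Proof.
move=> /(_ span_poset span_diagram M span_incl _ span_colimit)[].
  by move=> U V h x y /(congr1 (incl _)); rewrite !incl_inclusion => /incl_inj.
move=> /(_ idfun)[U [h hE]] _; have [g gE] := svalP (U : small_span).
exists g => V gV x; have : sval (U : small_span) x by rewrite [x]hE; apply: incl_mem.
by rewrite gE; apply: span_le => _ [a <-].
Qed.

End Generated.
End Presentability.

Section KaplanskyClass.
Variables (R : pzRingType) (Bc : lmodType R^c -> Prop).
Variables (X : lmodType R) (F : complex R) (i : {linear X -> F 0}).
Hypotheses (Fgood : good Bc F) (i_inj : injective i) (iE : exact_at i (diff F (- 1))).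
Variable U : subcomplex F.
Hypothesis Upure : pure U.

Let W : submod X := submod_preimage i (U 0).
Let iW x : W x -> U 0 (i x) := id.

(** [W] is the module of 0-cycles of the good complex U. *)
Lemma gorenstein_flat_sub : gorenstein_flat Bc (submod_type W).
Proof.
have [Uflat Uex Uac] := good_sub Fgood Upure.
exists (sub_complex U); split=> //; exists (restrict iW); split.
  by move=> x y /(congr1 (incl _)); rewrite !incl_restrict => /i_inj/incl_inj.
move=> y; split=> [y0|[x <-]].
  have [|x xy] := (iE (incl (U 0) y)).1.
    by have := congr1 (incl _) y0; rewrite linear0.
  have /inclP[w wx] : W x by rewrite /W submod_preimageE xy; apply: incl_mem.
  by exists w; apply: incl_inj; rewrite incl_restrict wx.
apply: incl_inj; rewrite linear0; apply/iE; by exists (incl W x).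
Qed.

(** The 0-cycles of F/U are Z_0(F)/W: if dz lies in U, purity gives u' in U_0 with du' = dz, and the
    cycle z - u' represents the class of z. *)
Lemma gorenstein_flat_quo : gorenstein_flat Bc (quomod_type W).
Proof.
have [Uflat Uex Uac] := good_quo Fgood Upure.
exists (quo_complex U); split=> //; exists (induced iW); split.
  move=> x y; have [[x' <-] [y' <-]] := (proj_surj x, proj_surj y).
  by rewrite !induced_proj => /proj_eq; rewrite -linearB => Wxy; apply/proj_eq.
move=> y; split=> [|[x <-]].
  have [z zy] := proj_surj y; subst y.
  move=> /(etrans (esym (induced_proj (@subcomplex_diff _ _ U (- 1)) z))).
  move=> /proj_eq0/inclP[u uE].
  have [_ [/(_ z u (esym uE))[u' u'E] _]] := Upure (- 1).
  have [|x xE] := (iE (z - incl _ u')).1.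
    by rewrite linearB -uE -u'E; apply: subrr.
  exists (proj W x); rewrite induced_proj xE.
  by apply/proj_eq; rewrite addrAC subrr sub0r; apply/submodN/incl_mem.
have [z <-] := proj_surj x; rewrite (induced_proj iW z).
rewrite [LHS](induced_proj (@subcomplex_diff _ _ U (- 1))).
by rewrite (_ : diff F (- 1) (i z) = 0) ?linear0 //; apply/iE; exists z.
Qed.

End KaplanskyClass.

Lemma gorenstein_flat_kaplansky (R : pzRingType) (Bc : lmodType R^c -> Prop) :
  kaplansky (gorenstein_flat Bc).
Proof.
have z0 : R + nat := inr 0%N.
pose k : smallType := kappa0 R.
have nat_k : injects nat k by apply/singleton_injects/nat_injects.
have k_square : injects (k * k) k by apply: (kappa_prod z0); apply: injects_refl.
have R_k : covered k (fun _ : R => True).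
  apply: (covered_injects (f := id) 0 (singleton_injects (ring_injects R))) => r _.
  by exists r.
have [K [Kreg lt_cov cov_lt]] := successor_cardinal nat_k k_square.
exists K; split=> // X M m [F [Fflat Fex Fac [i [i_inj iE]]]] [x0 x0N] m_inj Mgen.
have Fgood : good Bc F by [].
have [g gM] := generated_span nat_k k_square cov_lt lt_cov Mgen.
(* The nonzero element [x0] is added to the generators of M so that the resulting submodule is
   nonzero even when M is zero. *)
pose gens (o : option k) : homogeneous F :=
  of_degree (i (if o is Some a then m (g a) else x0)).
have [|U [Upure [e eU] Ugens]] := small_pure_hull gens None.
  by apply: (kappa_option z0); apply: injects_refl.
pose W : submod X := submod_preimage i (U 0).
have mW : forall z, (submod_preimage m W) z by apply: gM => a; apply: (Ugens (Some a)).
have [z|t tE] := factor_injective (h := m) (@incl_inj _ _ W).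
  by have /inclP[w wz] : W (m z) := mW z; exists w.
exists (submod_type W), (quomod_type W), t, (incl W), (proj W); split.
- have /inclP[w wE] : W x0 := Ugens None.
  by exists w => w0; apply: x0N; rewrite -wE w0 linear0.
- apply: presentable_covered nat_k k_square R_k cov_lt _ _.
  (* The enumeration of U is pulled back to [W] along the injective [i], with 0 as default for
     elements outside the image of [W]. *)
  have /choice[e' e'E] a : exists w, forall w', e a = of_degree (i (incl W w')) -> w' = w.
    have [[w wE]|nw] := pselect (exists w, e a = of_degree (i (incl W w))).
      by exists w => w'; rewrite wE => /of_degree_inj/i_inj/incl_inj.
    by exists 0 => w' w'E; case: nw; exists w'.
  exists e' => w _; have [|a aE] := eU (of_degree (i (incl W w))).
    exact: (incl_mem w).
  by exists a; apply/esym/e'E.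
- exact: tE.
- split; [exact: incl_inj| |exact: proj_surj].
  by move=> y; split=> [/proj_eq0/inclP //|[x <-]]; apply: proj_incl.
- by split; [apply: gorenstein_flat_sub|apply: gorenstein_flat_quo].
Qed.

Theorem proposition2p15 (R : pzRingType) (B : lmodType R^c -> Prop) :
  precovering (gorenstein_flat B) /\ kaplansky (gorenstein_flat B).
Proof.
split; [exact: gorenstein_flat_precovering|exact: gorenstein_flat_kaplansky].
Qed.
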